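(* For every $d\ge2$, $\Theta_d=\mathcal Z_{d,d}=\bigcup_{k\in\mathbb N}\mathcal Z_{d,k}=\mathrm{Conv}(\mathcal S_{d,d})$.
   Context: All random variables live on an atomless probability space. $\mathcal L^2$ is the set of non-degenerate real random variables with finite variance. For $X,Y\in\mathcal L^2$ and $r\in[-1,1]$, $(X,Y)$ has invariant correlation $r$ if $\mathrm{Corr}(X,Y)=\mathrm{Corr}(g(X),g(Y))=r$ for every measurable $g:\mathbb R\to\mathbb R$ with $g(X),g(Y)\in\mathcal L^2$. A $d$-dimensional random vector $\mathbf X=(X_1,\dots,X_d)$ (with components in $\mathcal L^2$) has invariant correlation matrix $R=(r_{ij})_{d\times d}$ if $(X_i,X_j)$ has invariant correlation $r_{ij}$ for all $i,j\in[d]$. $\Theta_d$ is the set of all $d\times d$ matrices that are invariant correlation matrices of some continuous $d$-dimensional random vector with identical marginals. A $d\times k$ categorical random matrix is a random matrix $\Gamma=(Z_{ij})_{d\times k}$ with entries in $\{0,1\}$ such that each row sums to $1$. $\mathcal Z_{d,k}$ is the set of all matrices $\mathbb E[\Gamma\Gamma^\top]$ with $\Gamma$ a $d\times k$ categorical random matrix. For a $k$-partition $\mathbf A=(A_1,\dots,A_k)$ of $[d]=\{1,\dots,d\}$ (some $A_s$ may be empty), the clique partition point $\Sigma^{\mathbf A}$ is the $d\times d$ matrix with entries $\Sigma^{\mathbf A}_{ij}=\sum_{s=1}^k\mathds 1_{\{i,j\in A_s\}}$. $\mathcal S_{d,k}$ is the set of all clique partition points over all $k$-partitions of $[d]$,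 and $\mathrm{Conv}$ denotes convex hull. *)

(* Defs.v *)
From HB Require Import structures.
From mathcomp Require Import all_boot all_order all_algebra.
From mathcomp Require Import all_classical all_reals all_analysis.
Set Implicit Arguments. Unset Strict Implicit. Unset Printing Implicit Defensive.
Import Order.TTheory GRing.Theory Num.Theory.
Local Open Scope classical_set_scope.
Local Open Scope ring_scope.

Section invariant_correlation.
Context {d0 : measure_display} {T : measurableType d0} {R : realType}
  (P : probability T R).

Definition atomless : Prop :=
  forall A : set T, measurable A -> (0 < P A)%E ->
    exists B : set T, [/\ measurable B, B `<=` A, (0 < P B)%E & (P B < P A)%E].

Definition nondegenerate (X : T -> R) : Prop :=
  ~ exists c : R, P [set w | X w = c] = 1%E.

Definition inL2 (X : T -> R) : Prop :=
  X \in Lfun P 2%:E /\ nondegenerate X.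

Definition corr (X Y : T -> R) : R :=
  fine (covariance P X Y) / Num.sqrt (fine 'V_P[X] * fine 'V_P[Y]).

Definition inv_corr (X Y : T -> R) (r : R) : Prop :=
  [/\ inL2 X, inL2 Y, corr X Y = r &
    forall g : R -> R, measurable_fun setT g ->
      inL2 (g \o X) -> inL2 (g \o Y) -> corr (g \o X) (g \o Y) = r].

Definition inv_corr_matrix (n : nat) (X : 'I_n -> T -> R) (M : 'M[R]_n) : Prop :=
  forall i j, inv_corr (X i) (X j) (M i j).

Definition continuous_rvec (n : nat) (X : 'I_n -> T -> R) : Prop :=
  forall i (x : R), P [set w | X i w = x] = 0%E.

Definition identical_marginals (n : nat) (X : 'I_n -> T -> R) : Prop :=
  forall i j (B : set R), measurable B -> P (X i @^-1` B) = P (X j @^-1` B).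

Definition Theta (n : nat) : set 'M[R]_n :=
  [set M | exists X : 'I_n -> T -> R,
     [/\ continuous_rvec X, identical_marginals X & inv_corr_matrix X M]].

Definition categorical (n k : nat) (G : T -> 'M[R]_(n, k)) : Prop :=
  [/\ forall i j, measurable_fun setT (fun w => G w i j),
      forall w i j, G w i j = 0 \/ G w i j = 1 &
      forall w i, \sum_(j < k) G w i j = 1].

Definition Zset (n k : nat) : set 'M[R]_n :=
  [set M | exists G : T -> 'M[R]_(n, k), categorical G /\
     M = \matrix_(i, j) fine ('E_P[fun w => (G w *m (G w)^T) i j])%E].

End invariant_correlation.

(* k-partitions of [n] (blocks may be empty) *)
Definition is_partition (n k : nat) (A : 'I_k -> {set 'I_n}) : Prop :=
  (forall s t, s != t -> (A s :&: A t == finset.set0)%SET) /\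
  (\bigcup_(s < k) A s)%SET = [set: 'I_n]%SET.

Definition clique_point (R : realType) (n k : nat) (A : 'I_k -> {set 'I_n})
  : 'M[R]_n :=
  \matrix_(i, j) \sum_(s < k) ((i \in A s) && (j \in A s))%:R.

Definition Sset (R : realType) (n k : nat) : set 'M[R]_n :=
  [set M | exists A : 'I_k -> {set 'I_n}, is_partition A /\ M = clique_point R A].

Definition conv_hull (R : realType) (n : nat) (S : set 'M[R]_n) : set 'M[R]_n :=
  [set M | exists (m : nat) (w : 'I_m -> R) (Q : 'I_m -> 'M[R]_n),
     [/\ forall i, 0 <= w i, \sum_(i < m) w i = 1, forall i, S (Q i) &
         M = \sum_(i < m) w i *: Q i]].

Arguments Theta {d0 T R} P n.
Arguments Zset {d0 T R} P n k.
Arguments Sset : clear implicits.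
Arguments conv_hull {R n} S.

(* Main.v *)
(** The theorem follows from the circle of inclusions
    Theta_n <= Z_(n,n) <= U_k Z_(n,k) <= Conv(S_(n,n)) <= Theta_n.

    If (X, Y) has invariant correlation r, continuous and equal marginals,
    then g = 1_A gives P(X in A, Y in A) = r p + (1 - r) p^2 with p = P(X in A).
    Summing over the cells cut out of the line by the first m rationals and
    letting m go to infinity, the sum of the p^2 tends to 0, so P(X = Y) = r.
    Hence an invariant correlation matrix has entries P(X_i = X_j), and the
    random equivalence relation X_i = X_j defines a categorical matrix.

    In the same way E[Gamma Gamma^T] has entries P(i and j are in the same
    category), and conditioning on the random partition of the indices writes
    it as a convex combination of clique partition points.

    Finally, a convex combination of clique points is realised by drawing a
    random partition with the given weights and giving to all the indices of
    the s-th block the same variable U_s, where the U_s are continuous,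
    identically distributed, pairwise independent and independent of the
    partition; they are built from fair coins, which exist because the
    probability space has no atoms. *)
Require Import Defs.
From HB Require Import structures.
From mathcomp Require Import all_boot all_order all_algebra.
From mathcomp Require Import all_classical all_reals all_analysis.
From mathcomp Require Import measurable_realfun ring lra zify.
Set Implicit Arguments. Unset Strict Implicit. Unset Printing Implicit
  Defensive.
Import Order.TTheory GRing.Theory Num.Theory.
Import numFieldNormedType.Exports.
Local Open Scope classical_set_scope.
Local Open Scope ring_scope.

(** * Real-valued probabilities and events of small probability *)

Section real_probability.
Context {d0 : measure_display} {T : measurableType d0} {R : realType}
  (P : probability T R).

Definition rprob (A : set T) : R := fine (P A).
Local Notation pr := rprob.

Lemma prK (A : set T) : measurable A -> P A = (pr A)%:E.
Proof. by move=> mA; rewrite /rprob fineK// fin_num_measure. Qed.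

Lemma pr_ge0 (A : set T) : 0 <= pr A.
Proof. exact/fine_ge0/measure_ge0. Qed.

Lemma pr_set0 : pr set0 = 0. Proof. by rewrite /rprob measure0. Qed.

Lemma pr_setT : pr setT = 1. Proof. by rewrite /rprob probability_setT. Qed.

Lemma le_pr (A B : set T) :
  measurable A -> measurable B -> A `<=` B -> pr A <= pr B.
Proof.
move=> mA mB AB; apply: fine_le; rewrite ?fin_num_measure//.
by apply: le_measure => //; rewrite inE.
Qed.

Lemma prU (A B : set T) : measurable A -> measurable B -> A `&` B = set0 ->
  pr (A `|` B) = pr A + pr B.
Proof.
by move=> mA mB AB; rewrite /rprob measureU// fineD// fin_num_measure.
Qed.

Lemma pr_split (A B : set T) : measurable A -> measurable B ->
  pr A = pr (A `&` B) + pr (A `\` B).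
Proof.
move=> mA mB; rewrite -prU ?setIUDK//; last 3 first.
- exact: measurableI.
- exact: measurableD.
- by rewrite setDE setIACA setICr setI0.
by congr pr; rewrite setDE -setIUr setUv setIT.
Qed.

Lemma prD (A B : set T) : measurable A -> measurable B -> B `<=` A ->
  pr (A `\` B) = pr A - pr B.
Proof.
move=> mA mB BA; have := pr_split mA mB.
by rewrite setIidr// => ->; rewrite addrAC subrr add0r.
Qed.

Lemma pr_nonincreasing_cvg (F : (set T)^nat) : (forall k, measurable (F k)) ->
  nonincreasing_seq F -> pr (F k) @[k --> \oo] --> pr (\bigcap_k F k).
Proof.
move=> mF dF; apply: fine_cvg; rewrite fineK ?fin_num_measure//; last first.
  exact: bigcapT_measurable.
apply: nonincreasing_cvg_mu => //; last exact: bigcapT_measurable.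
by rewrite -ge0_fin_numE// fin_num_measure.
Qed.

Lemma pr_nondecreasing_cvg (F : (set T)^nat) : (forall k, measurable (F k)) ->
  nondecreasing_seq F -> pr (F k) @[k --> \oo] --> pr (\bigcup_k F k).
Proof.
move=> mF dF; apply: fine_cvg; rewrite fineK ?fin_num_measure//; last first.
  exact: bigcupT_measurable.
by apply: nondecreasing_cvg_mu => //; exact: bigcupT_measurable.
Qed.

(** Total probability along a finite-valued label. Measurability is asked of the fibres of [L]
    because [I] carries no sigma-algebra. *)
Lemma pr_fibers (I : finType) (L : T -> I) (A : set T) : measurable A ->
  (forall i, measurable (L @^-1` [set i])) ->
  pr A = \sum_i pr (A `&` L @^-1` [set i]).
Proof.
move=> mA mL.
have fibers (s : seq I) : uniq s ->
    pr (A `&` [set w | L w \in s]) = \sum_(i <- s) pr (A `&` L @^-1` [set i])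
    /\ measurable (A `&` [set w | L w \in s]).
  elim: s => [_|i s IH /= /andP[nis us]].
    by rewrite big_nil [X in A `&` X](_ : _ = set0) ?setI0 ?pr_set0//;
      apply/seteqP; split.
  have [IHs ms] := IH us.
  have -> : A `&` [set w | L w \in i :: s] =
      (A `&` L @^-1` [set i]) `|` (A `&` [set w | L w \in s]).
    rewrite -setIUr; congr (_ `&` _); apply/seteqP; split=> w /=.
      by rewrite inE => /orP[/eqP|]; [left|right].
    by rewrite inE => -[->|->]; rewrite ?eqxx ?orbT.
  have mi : measurable (A `&` L @^-1` [set i]) by exact: measurableI.
  split; last exact: measurableU.
  rewrite big_cons -IHs prU//.
  by apply/seteqP; split=> w //= -[[_ Lw] [_]]; rewrite Lw (negbTE nis).
have [<- _] := fibers (index_enum I) (index_enum_uniq I).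
by congr pr; apply/seteqP; split=> w /=; [move=> Aw; split=> //;
  exact: mem_index_enum|case].
Qed.

(* Halving a set of positive probability infinitely often. *)
Lemma atomless_small (A : set T) (e : R) : atomless P -> measurable A ->
  0 < pr A -> 0 < e ->
  exists B, [/\ measurable B, B `<=` A, 0 < pr B & pr B < e].
Proof.
move=> atP mA A0 e0.
have small k : exists B, [/\ measurable B, B `<=` A, 0 < pr B & pr B <= 2 ^- k].
  elim: k => [|k [B [mB BA B0 Bk]]].
    exists A; split => //; rewrite expr0 invr1 -pr_setT; exact: le_pr.
  have [|C [mC CB C0 CltB]] := atP B mB; first by rewrite prK// lte_fin.
  move: C0 CltB; rewrite !prK// !lte_fin => C0 CltB.
  have k2 : 2 ^- k.+1 = 2 ^- k / 2 :> R by rewrite exprSr invfM.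
  have [Cle|Cgt] := leP (pr C) (2 ^- k.+1).
    by exists C; split => //; exact: subset_trans BA.
  exists (B `\` C); rewrite prD//; split.
  - exact: measurableD.
  - by apply: subset_trans BA => w [].
  - by rewrite subr_gt0.
  - lra.
have [k ke] : exists k, 2 ^- k < e :> R.
  have /cvgrPdist_lt/(_ _ e0)[k _ /(_ k (leqnn k))] :=
    @cvg_geometric R 1 (2^-1) (ltac:(rewrite ger0_norm; lra)).
  rewrite /= sub0r normrN mul1r ger0_norm ?exprVn// => ke; by exists k.
have [B [? ? ? Bk]] := small k; exists B; split => //; exact: le_lt_trans ke.
Qed.

End real_probability.

(** * Events of every intermediate probability *)

Section sierpinski.
Context {d0 : measure_display} {T : measurableType d0} {R : realType}
  (P : probability T R).
Local Notation pr := (rprob P).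

(* Greedily adding to the set a piece of at least half the largest admissible
   probability: if the union missed t, a fixed small piece would stay
   admissible for ever, and the probabilities would be unbounded. *)
Lemma sierpinski (A : set T) (t : R) : atomless P -> measurable A ->
  0 <= t <= pr A -> exists B, [/\ measurable B, B `<=` A & pr B = t].
Proof.
move=> atP mA /andP[t0 tA].
pose good B := [/\ measurable B, B `<=` A & pr B <= t].
pose adm B E := [/\ measurable E, E `<=` A `\` B & pr B + pr E <= t].
(* The premise [good B] stands under the existential so that [choice] returns a total map; a set
   that is not good is sent to itself. *)
have step B : exists C, good B -> [/\ good C, B `<=` C &
    forall E, adm B E -> pr E <= 2 * (pr C - pr B)].
  have [[mB BA Bt]|nB] := pselect (good B); last by exists B.
  pose S := [set pr E | E in adm B].
  have S0 : S 0.
    by exists set0; [split => //; rewrite pr_set0 addr0|exact: pr_set0].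
  have supS : has_sup S.
    split; first by exists 0.
    by exists t => _ [E [_ _ Et] <-]; apply: le_trans Et; rewrite lerDr pr_ge0.
  have ub := ub_le_sup supS.2.
  have [s0|s0] := leP (sup S) 0.
    exists B => _; split => // E aE.
    rewrite subrr mulr0; apply: le_trans s0; apply: ub; by exists E.
  have s2 : 0 < sup S / 2 by lra.
  have [_ [E [mE EAB Et] <-] sE] := sup_adherent s2 supS.
  have BE : pr (B `|` E) = pr B + pr E.
    by rewrite prU//; apply/seteqP; split=> w // [Bw /EAB[]].
  exists (B `|` E) => _; split.
  - split; [exact: measurableU| |by rewrite BE].
    by move=> w [/BA//|/EAB[]].
  - by left.
  - move=> E' aE'; have : pr E' <= sup S by apply: ub; exists E'.
    rewrite BE; lra.
have [next nextP] := choice step.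
pose F k := iter k next set0.
have gF k : good (F k).
  elim: k => [|k IH]; last by have [] := nextP _ IH.
  by split => //=; rewrite ?pr_set0.
have mF k : measurable (F k) by have [] := gF k.
have FS k : F k `<=` F k.+1 by have [] := nextP _ (gF k).
have ndF : nondecreasing_seq F.
  by apply/nondecreasing_seqP => k; apply/subsetPset.
set B := \bigcup_k F k.
have mB : measurable B by exact: bigcupT_measurable.
have BA : B `<=` A by move=> w [k _]; have [_ FA _] := gF k; exact: FA.
have Bt : pr B <= t.
  apply: (cvgr_to_le (pr_nondecreasing_cvg mF ndF)).
  by apply: nearW => k; have [] := gF k.
exists B; split => //; apply/eqP; rewrite eq_le Bt /= leNgt; apply/negP => Blt.
have [|||E [mE EAB E0 Et]] := @atomless_small _ _ _ P (A `\` B) (t - pr B) atP.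
- exact: measurableD.
- rewrite prD//; lra.
- lra.
have FB k : pr (F k) <= pr B by apply: le_pr => // w Fw; exists k.
have aE k : adm (F k) E.
  split => //; last by have := FB k; lra.
  by move=> w /EAB[Aw Bw]; split => // Fw; apply: Bw; exists k.
have grow k : k%:R * (pr E / 2) <= pr (F k).
  elim: k => [|k IH]; first by rewrite mul0r pr_ge0.
  have [_ _ /(_ _ (aE k))] := nextP _ (gF k).
  rewrite -[next (F k)]/(F k.+1) -[k.+1%:R]natr1 mulrDl mul1r; lra.
have E2 : 0 < pr E / 2 by lra.
have [k kt] : exists k : nat, t / (pr E / 2) < k%:R.
  exists (Num.bound (t / (pr E / 2))).
  by apply: archi_boundP; apply: divr_ge0 => //; lra.
move: kt; rewrite ltr_pdivrMr// => kt.
have := grow k; have := FB k; lra.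
Qed.

(** Pieces of the prescribed probabilities are cut off one after another. The induction runs over an
    arbitrary measurable set [A] in place of the whole space, since what remains after a cut no
    longer has probability one. *)
Lemma weighted_partition (m : nat) (w : 'I_m.+1 -> R) : atomless P ->
  (forall i, 0 <= w i) -> \sum_i w i = 1 ->
  exists f : T -> 'I_m.+1, forall i,
    measurable (f @^-1` [set i]) /\ pr (f @^-1` [set i]) = w i.
Proof.
move=> atP; suff gen (A : set T) : measurable A -> (forall i, 0 <= w i) ->
    \sum_i w i = pr A -> exists f : T -> 'I_m.+1, forall i,
    measurable (A `&` f @^-1` [set i]) /\ pr (A `&` f @^-1` [set i]) = w i.
  move=> w0 w1; have [| | |f fP] := gen setT; rewrite ?pr_setT//.
  by exists f => i; have := fP i; rewrite setTI.
elim: m A w => [|m IH] A w mA w0.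
  rewrite big_ord1 => wA; exists (fun=> ord0) => i.
  by rewrite (ord1 i) [X in A `&` X](_ : _ = setT) ?setIT ?wA//; apply/seteqP;
    split.
rewrite big_ord_recl => wA.
have [|B [mB BA Bw]] := @sierpinski A (w ord0) atP mA.
  by rewrite w0 -wA lerDl; apply: sumr_ge0.
have mAB : measurable (A `\` B) by exact: measurableD.
have [||f fP] := IH (A `\` B) (fun i => w (lift ord0 i)) mAB.
- by [].
- by rewrite prD// -wA Bw addrAC subrr add0r.
exists (fun x => if x \in B then ord0 else lift ord0 (f x)) => i.
have [->|[j ->]] : i = ord0 \/ exists j, i = lift ord0 j.
  by case: (unliftP ord0 i) => [j ->|->]; [right; exists j|left].
- rewrite [X in measurable X /\ pr X = _](_ : _ = B)//.
  apply/seteqP; split=> x /=; first by case: ifPn => [|_ []]; rewrite ?inE.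
  by move=> Bx; split; [exact: BA|rewrite ifT// inE].
- rewrite [X in measurable X /\ pr X = _](_ : _ = (A `\` B) `&` f @^-1` [set
  j]); first exact: (fP j).
  apply/seteqP; split=> x /=.
    case: ifPn => [_ []//|]; rewrite notin_setE => Bx [Ax /lift_inj ->//].
  by move=> [[Ax Bx] ->]; split => //; rewrite ifF//; apply/negbTE;
    rewrite notin_setE.
Qed.

End sierpinski.

(** * Fair coins, each independent of the past *)

Section coins.
Context {d0 : measure_display} {T : measurableType d0} {R : realType}
  (P : probability T R).
Local Notation pr := (rprob P).

Lemma measurable_preimage_nat (L : T -> nat) (S : set nat) :
  (forall i, measurable (L @^-1` [set i])) -> measurable (L @^-1` S).
Proof.
move=> mL; rewrite [X in measurable X](_ : _ = \bigcup_(i in S) L @^-1` [set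
  i]).
  exact: bigcup_measurable.
by apply/seteqP; split=> [w Sw|w [i + /= Lw]]; [exists (L w)|rewrite -Lw].
Qed.

(** Each fibre of [L] contains a subset of half its probability; the coin shows heads on the union
    of these halves. Countable additivity passes from single fibres to every [S]. *)
Lemma fair_coin (L : T -> nat) : atomless P ->
  (forall i, measurable (L @^-1` [set i])) ->
  exists b : T -> bool, measurable [set w | b w] /\
    forall S, pr (L @^-1` S `&` [set w | b w]) = pr (L @^-1` S) / 2.
Proof.
move=> atP mL.
have half i : exists B, [/\ measurable B, B `<=` L @^-1` [set i] &
    pr B = pr (L @^-1` [set i]) / 2].
  apply: sierpinski => //; have := pr_ge0 P (L @^-1` [set i]); lra.
have [B BP] := choice half.
have mB i : measurable (B i) by have [] := BP i.
exists (fun w => w \in B (L w)).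
have eqB S : L @^-1` S `&` [set w | w \in B (L w)] = \bigcup_(i in S) B i.
  apply/seteqP; split=> w /=; first by move=> [Sw /set_mem Bw]; exists (L w).
  by move=> [i Si Bw]; have [_ /(_ _ Bw) /= Lw _] := BP i; rewrite Lw mem_set.
split=> [|S].
  by rewrite -[X in measurable X]setTI -(preimage_setT L) eqB;
    exact: bigcup_measurable.
have tL : trivIset setT (fun i => L @^-1` [set i]).
  by move=> i j _ _ [w [<- <-]].
rewrite eqB; have -> : L @^-1` S = \bigcup_(i in S) L @^-1` [set i].
  by apply/seteqP; split=> [w Sw|w [i + /= Lw]]; [exists (L w)|rewrite -Lw].
suff EB : P (\bigcup_(i in S) B i) =
    ((2^-1)%:E * P (\bigcup_(i in S) L @^-1` [set i]))%E.
  rewrite /rprob EB fineM// ?fin_num_measure//; first by rewrite mulrC.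
  exact: bigcup_measurable.
rewrite !measure_bigcup//; last 2 first.
- by apply: sub_trivIset tL.
- move=> i j _ _ [w [Bi Bj]]; have [_ /(_ _ Bi) /= <- _] := BP i.
  by have [_ /(_ _ Bj) /= <- _] := BP j.
rewrite -nneseriesZl//; apply: eq_eseriesr => i _.
have [_ _ Bi] := BP i.
transitivity (pr (B i))%:E; first exact: prK.
rewrite Bi mulrC EFinM; congr (_ * _)%E; exact/esym/prK.
Qed.

(** Says that [E] lies in the sigma-algebra generated by [f] and the first [N] bits. These data take
    countably many values, so the pointwise condition is enough. *)
Definition determined (f : T -> nat) (b : nat -> T -> bool) (N : nat)
    (E : set T) :=
  forall w w', f w = f w' -> (forall j, (j < N)%N -> b j w = b j w') ->
    E w -> E w'.

Lemma determinedW (f : T -> nat) (b : nat -> T -> bool) (M N : nat)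
    (E : set T) : (M <= N)%N -> determined f b M E -> determined f b N E.
Proof.
move=> MN dE w w' fw bw; apply: dE => // j jM; apply: bw.
exact: leq_trans MN.
Qed.

(** The coins are tossed successively: the whole past, that is [f] and the first [N] bits, is coded
    by one natural number [L N], and [fair_coin] applied to [L N] gives bit [N]. *)
Lemma fair_coins (f : T -> nat) : atomless P ->
  (forall i, measurable (f @^-1` [set i])) ->
  exists b : nat -> T -> bool, forall N E, determined f b N E ->
    measurable E /\
    forall c, pr (E `&` [set w | b N w = c]) = pr E / 2.
Proof.
move=> atP mf.
have step (L : T -> nat) : exists b : T -> bool,
    (forall i, measurable (L @^-1` [set i])) -> measurable [set w | b w] /\
    forall S, pr (L @^-1` S `&` [set w | b w]) = pr (L @^-1` S) / 2.
  have [mL|nL] := pselect (forall i, measurable (L @^-1` [set i])).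
    by have [b bP] := fair_coin atP mL; exists b.
  by exists (fun=> true) => mL; exfalso; exact: nL.
have [coin coinP] := choice step.
(* Appending a binary digit loses nothing: halving recovers the old code and parity the new bit. *)
pose next (L : T -> nat) w := ((L w).*2 + coin L w)%N.
pose L k := iter k next f.
have mL k i : measurable (L k @^-1` [set i]).
  elim: k i => [|k IH] i; first exact: mf.
  have [mb _] := coinP _ IH.
  rewrite [X in measurable X](_ : _ =
      (L k @^-1` [set j | j.*2.+1 = i] `&` [set w | coin (L k) w]) `|`
      (L k @^-1` [set j | j.*2 = i] `\` [set w | coin (L k) w])).
    apply: measurableU; first by apply: measurableI => //;
      exact: measurable_preimage_nat.
    by apply: measurableD => //; exact: measurable_preimage_nat.
  apply/seteqP; split=> w; rewrite /L /= /next -/(L k); case: (coin _ w) => /=.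
  - by rewrite addn1 => ?; left.
  - by rewrite addn0 => ?; right.
  - by rewrite addn1 => -[[]|[]].
  - by rewrite addn0 => -[[]|[]].
exists (fun k => coin (L k)) => N E dE.
(* Decoding [L N] gives back [f] and all bits below [N], so a determined event is a preimage under
   [L N]. *)
have LE w w' : L N w = L N w' -> E w -> E w'.
  move=> LN; apply: dE.
    elim: N LN => [//|N IH]; rewrite /L /= /next -/(L N) => /(congr1 half).
    by rewrite ![(_.*2 + _)%N]addnC !half_bit_double => /IH.
  elim: N LN => [//|N IH]; rewrite /L /= /next -/(L N) => LN j.
  have LN2 : L N w = L N w'.
    by have /(congr1 half) := LN; rewrite ![(_.*2 + _)%N]addnC !half_bit_double.
  rewrite ltnS leq_eqVlt => /orP[/eqP->|]; last exact: IH.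
  by move: LN; rewrite LN2 => /addnI; case: (coin _ w); case: (coin _ w').
have -> : E = L N @^-1` (L N @` E).
  apply/seteqP; split=> w /=; first by exists w.
  by move=> [w' Ew' LN]; exact: LE Ew'.
have mLE := @measurable_preimage_nat _ (L N @` E) (mL N).
split => // -[]; have [mb bP] := coinP _ (mL N); first exact: bP.
have := pr_split P mLE mb; rewrite bP [X in pr (_ `&` X)](_ : _ = ~` [set w |
  coin (L N) w]).
  by rewrite setDE; lra.
by apply/seteqP; split=> w /=; case: (coin _ w).
Qed.

End coins.

(** * Laws and independence tested on rays *)

Section rays.
Context {d0 : measure_display} {T : measurableType d0} {R : realType}
  (P : probability T R).
Local Notation pr := (rprob P).

Lemma measurable_preimage (U : T -> R) (A : set R) :
  measurable_fun setT U -> measurable A -> measurable (U @^-1` A).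
Proof. by move=> mU mA; rewrite -[X in measurable X]setTI; exact: mU. Qed.

Lemma measurable_ray (U : T -> R) (x : R) :
  measurable_fun setT U -> measurable [set w | U w <= x].
Proof.
move=> mU; rewrite (_ : [set w | U w <= x] = U @^-1` `]-oo, x]%classic).
  exact: measurable_preimage.
by apply/seteqP; split=> w /=; rewrite in_itv.
Qed.

(** Both sides are finite measures in [A], and they agree on open upper rays, a generating family
    stable under intersection. The second variable [V] lets the law of [U] given [C] be compared
    with a fixed reference law. *)
Lemma independent_of_rays (C : set T) (U V : T -> R) : measurable C ->
    measurable_fun setT U -> measurable_fun setT V ->
    (forall x, pr (C `&` [set w | U w <= x]) =
               pr C * pr [set w | V w <= x]) ->
  forall A, measurable A -> pr (C `&` U @^-1` A) = pr C * pr (V @^-1` A).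
Proof.
move=> mC mU mV UV A mA.
have mpre W B : measurable_fun setT W -> measurable B ->
  measurable ((W : T -> R) @^-1` B) by exact: measurable_preimage.
pose Um : {mfun T >-> R} := HB.pack U (isMeasurableFun.Build _ _ _ _ _ mU).
pose Vm : {mfun T >-> R} := HB.pack V (isMeasurableFun.Build _ _ _ _ _ mV).
pose c : {nonneg R} := NngNum (pr_ge0 P C).
pose m1' : {measure set R -> \bar R} := pushforward (mrestr P mC) Um.
pose m1 := m1' mU.
pose m2 : {measure set R -> \bar R} := mscale c (distribution P Vm).
have m1E B : measurable B -> m1 B = (pr (C `&` U @^-1` B))%:E.
  move=> mB; rewrite /m1 /= /pushforward /mrestr setIC.
  by apply: prK; apply: measurableI => //; exact: mpre.
have m2E B : measurable B -> m2 B = (pr C * pr (V @^-1` B))%:E.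
  move=> mB; rewrite /m2 /= /mscale /pushforward EFinM; congr (_ * _)%E.
  exact: (prK P (mpre V B mV mB)).
suff : m1 A = m2 A by rewrite m1E// m2E// => -[].
apply: (measure_unique (@measurable_realfun.RGenOInfty.G R) (fun k => `]- k%:R,
  +oo[%classic)) => //.
- exact: measurable_realfun.RGenOInfty.measurableE.
- move=> _ _ [x ->] [y ->]; exists (Num.max x y).
  by apply/seteqP; split=> z /=; rewrite !in_itv /= !andbT gt_max => /andP.
- by move=> k; exists (- k%:R).
- apply/seteqP; split=> // x _; exists (Num.bound (- x)) => //=.
  rewrite in_itv /= andbT ltrNl; have [x0|x0] := leP 0 (- x);
    first exact: archi_boundP.
  by apply: lt_le_trans x0 _; exact: ler0n.
- move=> _ [x ->]; have mx : measurable `]x, +oo[%classic by exact: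
  measurable_itv.
  rewrite m1E// m2E//; congr EFin.
  (* The hypothesis concerns closed lower rays, the complements of the generators. *)
  have gt_ray (W : T -> R) :
      W @^-1` `]x, +oo[%classic = ~` [set w | W w <= x].
    by apply/seteqP; split=> w /=; rewrite in_itv /= andbT ltNge => /negP.
  have mle (W : T -> R) : measurable_fun setT W -> measurable [set w | W w <=
    x].
    exact: measurable_ray.
  rewrite !gt_ray -setDE -(setTD [set w | V w <= x]) (prD P measurableT (mle _
    mV) (@subsetT _ _)).
  by have := pr_split P mC (mle _ mU);
    rewrite UV pr_setT mulrBr mulr1 => {1}->; rewrite addrAC subrr add0r.
- move=> k; rewrite m1E; first exact: ltry.
  exact: measurable_itv.
Qed.

End rays.

(** * Atomless, pairwise independent variables made from coins *)

Section digits.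
Context {d0 : measure_display} {T : measurableType d0} {R : realType}
  (P : probability T R) (f : T -> nat) (b : nat -> T -> bool) (n : nat).
Local Notation pr := (rprob P).
Context (coins : forall N E, determined f b N E -> measurable E /\
    forall c, pr (E `&` [set w | b N w = c]) = pr E / 2).

(* The j-th digit of the s-th variable is the bit j * n + s. Base 3 makes
   expansions with digits 0 and 1 unique, so that the limit has no atoms. *)
Definition partial_digits (k s : nat) (w : T) : R :=
  \sum_(j < k) 3 ^- j.+1 * (b (j * n + s) w)%:R.

(** The law of a sum of [k] fair base-3 digits, obtained by averaging over the last digit. It
    mentions neither [s] nor [P], so it serves as the common law of all the variables. *)
Fixpoint partial_law (k : nat) (A : set R) : R :=
  if k is k'.+1 then
    (partial_law k' A + partial_law k' [set x | A (x + 3 ^- k)]) / 2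
  else \1_A 0.

Lemma partialS k s w :
  partial_digits k.+1 s w = partial_digits k s w + 3 ^- k.+1 * (b (k * n + s)
    w)%:R.
Proof. by rewrite /partial_digits big_ord_recr. Qed.

Lemma partial_determined k s (A : set R) : (s < n)%N ->
  determined f b (k * n) [set w | A (partial_digits k s w)].
Proof.
move=> sn w w' _ bw /=; suff -> : partial_digits k s w = partial_digits k s w'
  by [].
apply: eq_bigr => j _; rewrite bw//.
have := ltn_ord j; nia.
Qed.

Lemma determinedI N (A B : set T) : determined f b N A -> determined f b N B ->
  determined f b N (A `&` B).
Proof.
move=> dA dB w w' fw bw [Aw Bw].
by split; [exact: (dA w w')|exact: (dB w w')].
Qed.

Lemma determined_bit N c : determined f b N.+1 [set w | b N w = c].
Proof. by move=> w w' _ bw /= <-; rewrite bw. Qed.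

Lemma two_coins N i j (E : set T) c c' : determined f b N E ->
  (N <= i)%N -> (i < j)%N ->
  pr (E `&` [set w | b i w = c] `&` [set w | b j w = c']) = pr E / 4.
Proof.
move=> dE Ni ij; have dEi := determinedW Ni dE.
have dF : determined f b i.+1 (E `&` [set w | b i w = c]).
  apply: determinedI; last exact: determined_bit.
  exact: determinedW dEi.
have [_ ->] := coins (determinedW ij dF); have [_ ->] := coins dEi; lra.
Qed.

Lemma measurable_bit N c : measurable [set w | b N w = c].
Proof. by have [] := coins (determined_bit (N := N) (c := c)). Qed.

Lemma pr_split_bit N (E : set T) : measurable E ->
  pr E = pr (E `&` [set w | b N w = true]) + pr (E `&` [set w | b N w = false]).
Proof.
move=> mE; rewrite (pr_split P mE (measurable_bit N true)); congr (_ + pr _).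
rewrite setDE; congr (_ `&` _).
by apply/seteqP; split=> w /=; case: (b N w).
Qed.

(** By induction on [k], conditioning on the last digit: a digit 1 replaces [A] by a translate, a
    digit 0 leaves it unchanged. [A] can be any set since the partial sum is a function of finitely
    many bits. *)
Lemma partial_lawE k s (E : set T) (A : set R) : (s < n)%N ->
  determined f b 0 E ->
  pr (E `&` [set w | A (partial_digits k s w)]) = pr E * partial_law k A.
Proof.
move=> sn dE; elim: k A => [|k IH] A.
  rewrite /= indicE; have [/set_mem A0|/negP A0] := boolP (0 \in A).
    rewrite mulr1 [X in E `&` X](_ : _ = setT) ?setIT//.
    by apply/seteqP; split=> w //= _; rewrite /partial_digits big_ord0.
  rewrite mulr0 [X in E `&` X](_ : _ = set0) ?setI0 ?pr_set0//.
  apply/seteqP; split=> w //=; rewrite /partial_digits big_ord0 => A0'.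
  by apply: A0; exact: mem_set.
have dk B : determined f b (k * n + s) (E `&` [set w | B (partial_digits k s
  w)]).
  apply: determinedI; first exact: determinedW dE.
  by apply: determinedW (partial_determined (k := k) (A := B) sn);
    exact: leq_addr.
have dk1 : determined f b (k.+1 * n) (E `&` [set w | A (partial_digits k.+1 s
  w)]).
  by apply: determinedI; [exact: determinedW dE|exact: partial_determined].
have [mE1 _] := coins dk1.
rewrite (pr_split_bit (k * n + s) mE1) /=.
have -> : E `&` [set w | A (partial_digits k.+1 s w)] `&` [set w | b (k * n +
  s) w = true] =
    E `&` [set w | [set x | A (x + 3 ^- k.+1)] (partial_digits k s w)] `&`
    [set w | b (k * n + s) w = true].
  apply/seteqP; split=> w /= [] [Ew]; rewrite partialS => + bw;
    by rewrite bw mulr1.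
have -> : E `&` [set w | A (partial_digits k.+1 s w)] `&` [set w | b (k * n +
  s) w = false] =
    E `&` [set w | A (partial_digits k s w)] `&` [set w | b (k * n + s) w =
      false].
  apply/seteqP; split=> w /= [] [Ew]; rewrite partialS => + bw;
    by rewrite bw mulr0 addr0.
have [_ ->] := coins (dk [set x | A (x + 3 ^- k.+1)]).
have [_ ->] := coins (dk A).
rewrite !IH; lra.
Qed.

(** By symmetry [s < t], so the new bit [i] of [s] is tossed before the new bit [j] of [t], and both
    after every bit used by the first [k] digits. Given that past, the four values of the pair are
    equally likely. *)
Lemma partial_law2 k s t (E : set T) (A B : set R) :
  (s < n)%N -> (t < n)%N -> s != t -> determined f b 0 E ->
  pr (E `&` [set w | A (partial_digits k s w)] `&` [set w | B (partial_digits k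
    t w)]) =
  pr E * partial_law k A * partial_law k B.
Proof.
wlog st : s t A B / (s < t)%N => [hwlog|] sn tn neq dE.
  case: (ltngtP s t) neq => // [st|ts] _.
    by apply: hwlog => //; rewrite ltn_eqF.
  by rewrite setIAC hwlog// ?ltn_eqF// mulrAC.
elim: k A B => [|k IH] A B.
  rewrite -setIA [X in E `&` X](_ : _ =
      [set w | (A `&` B) (partial_digits 0 s w)]); last first.
    by apply/seteqP; split=> w /=; rewrite /partial_digits !big_ord0.
  rewrite partial_lawE//= !indicE in_setI -mulrA -natrM mulnb.
  by [].
set i := (k * n + s)%N; set j := (k * n + t)%N.
have dk A' B' : determined f b (k * n) (E `&` [set w | A' (partial_digits k s
  w)]
    `&` [set w | B' (partial_digits k t w)]).
  apply: determinedI; last exact: partial_determined.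
  by apply: determinedI; [exact: determinedW dE|exact: partial_determined].
have dk1 : determined f b (k.+1 * n) (E `&` [set w | A (partial_digits k.+1 s
  w)]
    `&` [set w | B (partial_digits k.+1 t w)]).
  apply: determinedI; last exact: partial_determined.
  by apply: determinedI; [exact: determinedW dE|exact: partial_determined].
have bits c c' : pr (E `&` [set w | A (partial_digits k.+1 s w)]
    `&` [set w | B (partial_digits k.+1 t w)] `&` [set w | b i w = c]
    `&` [set w | b j w = c']) =
    pr E * partial_law k [set x | A (x + 3 ^- k.+1 * c%:R)] *
    partial_law k [set x | B (x + 3 ^- k.+1 * c'%:R)] / 4.
  rewrite -IH -(@two_coins (k * n) i j _ c c')//; last 2 first.
  - exact: leq_addr.
  - by rewrite ltn_add2l.
  congr pr; apply/seteqP; split=> w /= [[[[Ew]]]]; rewrite !partialS -/i -/j;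
    by move=> + + bi bj; rewrite bi bj.
have [mE1 _] := coins dk1.
have mE1b c : measurable (E `&` [set w | A (partial_digits k.+1 s w)]
    `&` [set w | B (partial_digits k.+1 t w)] `&` [set w | b i w = c]).
  by apply: measurableI => //; exact: measurable_bit.
rewrite (pr_split_bit i mE1) !(pr_split_bit j (mE1b _)) !bits /=.
have shift0 (C : set R) : [set x | C (x + 3 ^- k.+1 * 0)] = C.
  by apply/seteqP; split=> x /=; rewrite mulr0 addr0.
have shift1 (C : set R) :
    [set x | C (x + 3 ^- k.+1 * 1)] = [set x | C (x + 3 ^- k.+1)].
  by apply/seteqP; split=> x /=; rewrite mulr1.
by rewrite !shift0 !shift1; field.
Qed.

Definition digits (s : nat) (w : T) : R := limn (fun k => partial_digits k s w).

(** The digits from position [k] on add at most the geometric tail [3 ^- k / 2]; adding this tail to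
    the partial sums makes them nonincreasing. *)
Lemma partial_bounds j k s w : (j <= k)%N ->
  partial_digits j s w <= partial_digits k s w /\
  partial_digits k s w + 3 ^- k / 2 <= partial_digits j s w + 3 ^- j / 2.
Proof.
move=> /subnK <-; elim: (k - j)%N => [|i [IH1 IH2]]; first by rewrite add0n.
rewrite addSn partialS exprS invfM.
have : 0 <= 3 ^- (i + j) :> R by rewrite invr_ge0 exprn_ge0.
by case: (b _ w) => /= h; lra.
Qed.

Lemma partial_nondecreasing s w : nondecreasing_seq (fun k => partial_digits k
  s w).
Proof. by move=> j k /(partial_bounds s w)[]. Qed.

Lemma partial_cvg s w : partial_digits k s w @[k --> \oo] --> digits s w.
Proof.
apply: nondecreasing_is_cvgn; first exact: partial_nondecreasing.
exists (partial_digits 0 s w + 3 ^- 0 / 2) => _ [k _ <-].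
have [_] := partial_bounds s w (leq0n k); apply: le_trans.
by rewrite lerDl divr_ge0// invr_ge0 exprn_ge0.
Qed.

Lemma digits_bounds k s w :
  partial_digits k s w <= digits s w <= partial_digits k s w + 3 ^- k / 2.
Proof.
apply/andP; split.
  apply: nondecreasing_cvgn_le (@partial_nondecreasing s w) _ k.
  exact/cvgP/partial_cvg.
apply: (cvgr_to_le (@partial_cvg s w)); exists k => // m /= km.
have [_] := partial_bounds s w km; apply: le_trans.
by rewrite lerDl divr_ge0// invr_ge0 exprn_ge0.
Qed.

(** The partial sums increase to their limit, so a closed lower ray turns into a decreasing
    intersection, to which continuity from above applies. *)
Lemma digits_le s x :
  [set w | digits s w <= x] = \bigcap_k [set w | partial_digits k s w <= x].
Proof.
apply/seteqP; split=> w /=.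
  by move=> Ux k _ /=; apply: le_trans Ux; have /andP[] := digits_bounds k s w.
move=> Xx; apply: (cvgr_to_le (@partial_cvg s w)).
by apply: nearW => k; exact: Xx.
Qed.

(** At a first disagreement in digit [k], after a common partial sum [p], the digit 1 gives at least
    [p + 3 ^- k.+1] and the digit 0 at most [p + 3 ^- k.+1 / 2]. *)
Lemma digits_inj s w w' : digits s w = digits s w' ->
  forall k, b (k * n + s) w = b (k * n + s) w'.
Proof.
move=> Uww'.
have bit k : partial_digits k s w = partial_digits k s w' -> b (k * n + s) w =
  b (k * n + s) w'.
  move=> pk; have := digits_bounds k.+1 s w; have := digits_bounds k.+1 s w'.
  have : 0 < 3 ^- k.+1 :> R by rewrite invr_gt0 exprn_gt0.
  rewrite -Uww' !partialS pk.
  by case: (b _ w); case: (b _ w') => //= h /andP[? ?] /andP[? ?]; exfalso; lra.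
move=> k; apply: (bit k); elim: k => [|k IH];
  first by rewrite /partial_digits !big_ord0.
by rewrite !partialS IH bit.
Qed.

Lemma digits_ray s x (E : set T) : (s < n)%N -> determined f b 0 E ->
  (fun k => pr E * partial_law k [set y | y <= x]) @ \oo -->
    pr (E `&` [set w | digits s w <= x]).
Proof.
move=> sn dE; rewrite digits_le -bigcapIr; last by apply: ex_intro 0%N _.
rewrite [X in X @ _ --> _](_ : _ = fun k => pr (E `&` [set w | partial_digits k
  s w <= x])).
  apply: pr_nonincreasing_cvg => [k|j k jk].
    have dk : determined f b (k * n) (E `&` [set w | partial_digits k s w <=
      x]).
      apply: determinedI; first exact: determinedW dE.
      exact: (partial_determined (A := [set y | y <= x])).
    by have [] := coins dk.
  apply/subsetPset => w [Ew /= Xw]; split => //.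
  by apply: le_trans Xw; have [] := partial_bounds s w jk.
apply/funext => k.
by rewrite -(partial_lawE (s := s) k [set y | y <= x] sn dE).
Qed.

Lemma digits_ray2 s t x y (E : set T) : (s < n)%N -> (t < n)%N -> s != t ->
  determined f b 0 E ->
  (fun k => pr E * partial_law k [set z | z <= x] * partial_law k [set z | z <=
    y])
    @ \oo -->
    pr (E `&` [set w | digits s w <= x] `&` [set w | digits t w <= y]).
Proof.
move=> sn tn st dE; rewrite !digits_le -setIA -bigcapI -bigcapIr;
  last by apply: ex_intro 0%N _.
rewrite [X in X @ _ --> _](_ : _ = fun k =>
    pr (E `&` ([set w | partial_digits k s w <= x] `&` [set w | partial_digits
      k t w <= y]))).
  apply: pr_nonincreasing_cvg => [k|j k jk].
    have dk : determined f b (k * n)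
        (E `&` ([set w | partial_digits k s w <= x] `&` [set w | partial_digits
          k t w <= y])).
      apply: determinedI; first exact: determinedW dE.
      apply: determinedI; first exact: (partial_determined (A :=
        [set z | z <= x])).
      exact: (partial_determined (A := [set z | z <= y])).
    by have [] := coins dk.
  apply/subsetPset => w [Ew [/= Xw Yw]]; split => //; split => /=.
    by apply: le_trans Xw; have [] := partial_bounds s w jk.
  by apply: le_trans Yw; have [] := partial_bounds t w jk.
apply/funext => k; rewrite setIA.
by rewrite -(partial_law2 k [set z | z <= x] [set z | z <= y] sn tn st dE).
Qed.

Lemma determinedT : determined f b 0 setT. Proof. by []. Qed.

Lemma measurable_digits s : (s < n)%N -> measurable_fun setT (digits s).
Proof.
move=> sn; apply: (@measurable_fun_cvg _ _ _ _ (fun k w => partial_digits k s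
  w)); last first.
  by move=> w _; exact: partial_cvg.
move=> k; apply: measurable_sum => j; apply: measurable_funM => //.
rewrite (_ : (fun w => _) = \1_[set w | b (j * n + s) w = true]).
  apply: measurable_indic; exact: measurable_bit.
by apply/funext => w; rewrite indicE; congr (nat_of_bool _)%:R;
  apply/idP/idP => [bw|/set_mem//]; rewrite inE.
Qed.

(** Both sides are the limit of [pr E * partial_law k [set y | y <= x]], in which [s] does not
    occur. Variable 0 is taken as the reference. *)
Lemma ray_law s x (E : set T) : (s < n)%N -> determined f b 0 E ->
  pr (E `&` [set w | digits s w <= x]) = pr E * pr [set w | digits 0 w <= x].
Proof.
move=> sn dE; have n0 : (0 < n)%N by exact: leq_ltn_trans sn.
have := @digits_ray 0 x setT n0 determinedT; rewrite setTI pr_setT => h0.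
have -> : pr E = pr E * 1 by rewrite mulr1.
have h := digits_ray (x := x) sn dE.
apply: (cvg_unique _ h); rewrite //= ?mulr1.
by under eq_fun do rewrite -[partial_law _ _]mul1r; apply: cvgMr.
Qed.

Lemma ray_law2 s t x y (E : set T) : (s < n)%N -> (t < n)%N -> s != t ->
  determined f b 0 E ->
  pr (E `&` [set w | digits s w <= x] `&` [set w | digits t w <= y]) =
  pr E * pr [set w | digits 0 w <= x] * pr [set w | digits 0 w <= y].
Proof.
move=> sn tn st dE; have n0 : (0 < n)%N by exact: leq_ltn_trans sn.
have hx := @digits_ray 0 x setT n0 determinedT.
have hy := @digits_ray 0 y setT n0 determinedT.
rewrite !setTI pr_setT in hx hy.
have h := digits_ray2 (x := x) (y := y) sn tn st dE.
apply: (cvg_unique _ h) => //=.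
under eq_fun do rewrite -[partial_law _ [set z | z <= x]]mul1r
  -[partial_law _ [set z | z <= y]]mul1r.
by apply: cvgM => //; apply: cvgM => //; exact: cvg_cst.
Qed.

Lemma digits_law s (E : set T) (A : set R) : (s < n)%N ->
  determined f b 0 E -> measurable A ->
  pr (E `&` digits s @^-1` A) = pr E * pr (digits 0 @^-1` A).
Proof.
move=> sn dE; apply: independent_of_rays => [|||x].
- by have [] := coins dE.
- exact: measurable_digits.
- by apply: measurable_digits; exact: leq_ltn_trans sn.
- exact: ray_law.
Qed.

(** The rays are extended to Borel sets one coordinate at a time: first [B], given [E] and the event
    on [s]; then [A], given [E] and a ray event on [t]. *)
Lemma digits_law2 s t (E : set T) (A B : set R) : (s < n)%N -> (t < n)%N ->
  s != t -> determined f b 0 E -> measurable A -> measurable B ->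
  pr (E `&` digits s @^-1` A `&` digits t @^-1` B) =
  pr E * pr (digits 0 @^-1` A) * pr (digits 0 @^-1` B).
Proof.
move=> sn tn st dE mA mB; have n0 : (0 < n)%N by exact: leq_ltn_trans sn.
have [mE _] := coins dE.
have mdA : measurable (E `&` digits s @^-1` A).
  by apply: measurableI => //; apply: measurable_preimage => //;
    exact: measurable_digits.
rewrite -(digits_law sn dE mA); apply: independent_of_rays => // [||y].
- exact: measurable_digits.
- exact: measurable_digits.
have mty : measurable [set w | digits t w <= y].
  by apply: measurable_ray; exact: measurable_digits.
rewrite setIAC (digits_law sn dE mA) mulrAC -(ray_law y tn dE).
move: A mA mdA => A mA _; move: A mA; apply: independent_of_rays => [|||x].
- exact: measurableI.
- exact: measurable_digits.
- exact: measurable_digits.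
by rewrite setIAC ray_law2// mulrAC ray_law.
Qed.

(** If [x] is attained at [w0], every point of the event has the same bits [k * n + s] as [w0];
    agreement on the first [k] of them has probability [2 ^- k]. *)
Lemma digits_continuous s x : (s < n)%N -> pr [set w | digits s w = x] = 0.
Proof.
move=> sn; have [[w0 Uw0]|noU] := pselect (exists w, digits s w = x);
  last first.
  rewrite (_ : [set w | digits s w = x] = set0) ?pr_set0//.
  by apply/seteqP; split=> w //= Uw; apply: noU; exists w.
have mU : measurable [set w | digits s w = x].
  rewrite (_ : [set w | _ = _] = digits s @^-1` [set x])//.
  by apply: measurable_preimage => //; exact: measurable_digits.
pose D k := [set w | forall j, (j < k)%N -> b (j * n + s) w = b (j * n + s) w0].
have dD k : determined f b (k * n) (D k).
  move=> w w' _ bw Dw j jk; rewrite -bw ?Dw//.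
  nia.
have prD k : pr (D k) = 2 ^- k.
  elim: k => [|k IH].
    by rewrite expr0 invr1 -(pr_setT P); congr pr; apply/seteqP; split.
  have dk : determined f b (k * n + s) (D k) by apply: determinedW (dD k);
    exact: leq_addr.
  have [_ /(_ (b (k * n + s) w0))] := coins dk.
  rewrite IH exprSr invfM => <-; congr pr; apply/seteqP; split=> w /=.
    by move=> Dw; split=> [j jk|]; apply: Dw => //; exact: leqW.
  by move=> [Dw bw] j; rewrite ltnS leq_eqVlt => /orP[/eqP->|] //; exact: Dw.
apply/eqP; rewrite eq_le pr_ge0 andbT.
have c2 : (2^-1 ^+ k : R) @[k --> \oo] --> 0.
  by apply: cvg_expr; rewrite ger0_norm; lra.
apply: (cvgr_to_ge c2); apply: nearW => k; rewrite exprVn -prD.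
apply: le_pr => //; first by have [] := coins (dD k).
by move=> w /= Uw j _; apply: digits_inj; rewrite Uw.
Qed.

End digits.

(** * Mixtures of a diagonal law and a product law *)

Lemma integrable_mscale d (T : measurableType d) (R : realType)
    (m : {measure set T -> \bar R}) (c : {nonneg R}) (h : T -> \bar R) :
  m.-integrable setT h -> (mscale c m).-integrable setT h.
Proof.
move=> /integrableP[mh hoo]; apply/integrableP; split => //.
rewrite ge0_integral_mscale//; last exact: measurableT_comp.
by rewrite lte_mul_pinfty// lee_fin.
Qed.

Lemma integral_mscale d (T : measurableType d) (R : realType)
    (m : {measure set T -> \bar R}) (c : {nonneg R}) (h : T -> \bar R) :
  m.-integrable setT h ->
  (\int[mscale c m]_x h x = (c%:num)%:E * \int[m]_x h x)%E.
Proof.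
move=> ih; have mh := measurable_int _ ih.
rewrite [LHS]integralE [X in (_ * X)%E]integralE !ge0_integral_mscale//.
- rewrite [RHS]muleBr// fin_num_adde_defr//.
  by apply: integrable_fin_num => //; exact: integrable_funepos.
- exact: measurable_funeneg.
- exact: measurable_funepos.
Qed.

Section mixture.
Context {d0 : measure_display} {T : measurableType d0} {R : realType}
  (P : probability T R).
Local Notation pr := (rprob P).

Lemma integral_same_law d (S : measurableType d) (X Y : T -> S)
    (h : S -> \bar R) :
  measurable_fun setT X -> measurable_fun setT Y ->
  (forall A, measurable A -> P (X @^-1` A) = P (Y @^-1` A)) ->
  measurable_fun setT h ->
  P.-integrable setT (h \o X) -> P.-integrable setT (h \o Y) ->
  (\int[P]_w h (X w) = \int[P]_w h (Y w))%E.
Proof.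
move=> mX mY XY mh ihX ihY.
pose Xm : {mfun T >-> S} := HB.pack X (isMeasurableFun.Build _ _ _ _ _ mX).
pose Ym : {mfun T >-> S} := HB.pack Y (isMeasurableFun.Build _ _ _ _ _ mY).
transitivity (\int[distribution P Xm]_y h y)%E.
  by rewrite (integral_distribution (X := Xm)).
transitivity (\int[distribution P Ym]_y h y)%E.
  by apply: eq_measure_integral => A mA _; exact: XY.
by rewrite (integral_distribution (X := Ym)).
Qed.

(** The hypothesis says that the law of [(X, Y)] is [r] times the law of [(X, X)] plus [1 - r] times
    the product of the law of [X] with itself. The function [h], the product of [g] at both
    coordinates, is integrated against each part. *)
Lemma expectation_mixture (X Y : T -> R) (r : R) (g : R -> R) :
  0 <= r <= 1 -> measurable_fun setT X -> measurable_fun setT Y ->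
  measurable_fun setT g ->
  (forall A B, measurable A -> measurable B ->
    pr (X @^-1` A `&` Y @^-1` B) =
    r * pr (X @^-1` (A `&` B)) + (1 - r) * (pr (X @^-1` A) * pr (X @^-1` B))) ->
  g \o X \in Lfun P 2%:E -> g \o Y \in Lfun P 2%:E ->
  ('E_P[(g \o X) * (g \o Y)] =
    r%:E * 'E_P[(g \o X) * (g \o X)] + (1 - r)%:E * ('E_P[g \o X] * 'E_P[g \o
      X]))%E.
Proof.
move=> /andP[r0 r1] mX mY mg XY gX2 gY2.
have r1' : 0 <= 1 - r by rewrite subr_ge0.
pose Xm : {mfun T >-> R} := HB.pack X (isMeasurableFun.Build _ _ _ _ _ mX).
pose nu : probability R R := distribution P Xm.
pose XYf := fun w => (X w, Y w); pose XXf := fun w => (X w, X w).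
have mXY : measurable_fun setT XYf by exact: measurable_fun_pair.
have mXX : measurable_fun setT XXf by exact: measurable_fun_pair.
pose XYm : {mfun T >-> (R * R)%type} :=
  HB.pack XYf (isMeasurableFun.Build _ _ _ _ _ mXY).
pose XXm : {mfun T >-> (R * R)%type} :=
  HB.pack XXf (isMeasurableFun.Build _ _ _ _ _ mXX).
pose m1 : {measure set (R * R) -> \bar R} := distribution P XYm.
pose m2 : {measure set (R * R) -> \bar R} :=
  mscale (NngNum r0) (distribution P XXm).
pose m3 : {measure set (R * R) -> \bar R} := mscale (NngNum r1') (nu \x nu)%E.
pose h (z : R * R) : \bar R := (g z.1 * g z.2)%:E.
have nuE A : measurable A -> nu A = (pr (X @^-1` A))%:E.
  move=> mA; exact: (prK P (measurable_preimage mX mA)).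
(* Rectangles are stable under intersection and generate the product sigma-algebra. *)
have joint A : measurable A -> m1 A = measure_add m2 m3 A.
  pose G := [set C : set (R * R) | exists A, measurable A /\
      exists B, measurable B /\ C = A `*` B].
  apply: (measure_unique G (fun=> setT)) => //.
  - rewrite measurable_prod_measurableType //; congr (<<s _ >>).
    apply/seteqP; split=> [C [A1 mA1 [B1 mB1 <-]]|C [A1 [mA1 [B1 [mB1 ->]]]]].
      by exists A1; split => //; exists B1.
    by exists A1 => //; exists B1.
  - move=> _ _ [A1 [mA1 [B1 [mB1 ->]]]] [A2 [mA2 [B2 [mB2 ->]]]].
    rewrite -setXI; exists (A1 `&` A2); split; first exact: measurableI.
    by exists (B1 `&` B2); split => //; exact: measurableI.
  - by move=> _; exists setT; split => //; exists setT; split => //;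
    rewrite setXTT.
  - by rewrite bigcup_const//; exists 0%N.
  - move=> _ [A1 [mA1 [B1 [mB1 ->]]]].
    have m1E : m1 (A1 `*` B1) = (pr (X @^-1` A1 `&` Y @^-1` B1))%:E.
      exact: (prK P (measurableI _ _ (measurable_preimage mX mA1)
                                     (measurable_preimage mY mB1))).
    have m2E : m2 (A1 `*` B1) = (r * pr (X @^-1` (A1 `&` B1)))%:E.
      rewrite EFinM; congr (_ * _)%E.
      exact: (prK P (measurableI _ _ (measurable_preimage mX mA1)
                                     (measurable_preimage mX mB1))).
    transitivity (m2 (A1 `*` B1) + m3 (A1 `*` B1))%E; last first.
      exact/esym/measure_addE.
    rewrite m1E m2E XY// EFinD; congr (_ + _)%E.
    rewrite /m3 /= /mscale /= product_measure1E//.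
    by rewrite EFinM; congr (_ * _)%E; rewrite EFinM -!nuE.
  - by move=> k; rewrite (@le_lt_trans _ _ 1%E)// ?ltry// probability_le1.
have gX1 : g \o X \in Lfun P 1 by apply: Lfun_subset12 => //;
  exact: fin_num_measure.
have mg1 : measurable_fun setT (fun z : R * R => g z.1).
  by apply: measurableT_comp.
have mg2 : measurable_fun setT (fun z : R * R => g z.2).
  by apply: measurableT_comp.
have mh : measurable_fun setT h by apply/measurable_EFinP;
  exact: measurable_funM.
have ihXY : P.-integrable setT (h \o XYf).
  by have /Lfun1_integrable := Lfun2_mul_Lfun1 gX2 gY2.
have ihXX : P.-integrable setT (h \o XXf).
  by have /Lfun1_integrable := Lfun2_mul_Lfun1 gX2 gX2.
have igX : P.-integrable setT ((EFin \o g) \o X) by have /Lfun1_integrable :=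
  gX1.
have mEg : measurable_fun setT (EFin \o g) by exact/measurable_EFinP.
have ig : nu.-integrable setT (EFin \o g) by exact: integrable_pushforward.
have gnu : (\int[nu]_x (g x)%:E = 'E_P[g \o X])%E.
  by rewrite unlock (integral_distribution (X := Xm)).
have fg : (\int[nu]_x (g x)%:E)%E \is a fin_num by rewrite integrable_fin_num.
(* The iterated integral of the absolute value of [h] is the square of that of [g], finite because
   [g] is integrable for [nu]. *)
have i3 : (nu \x nu)%E.-integrable setT h.
  apply/integrable12ltyP => //.
  under eq_integral => x _.
    under eq_integral => y _ do rewrite /h /= normrM EFinM.
    rewrite ge0_integralZl//; last first.
      by apply: measurableT_comp => //; apply: measurableT_comp.
    over.
  have /integrableP[_ gooo] := ig.
  rewrite ge0_integralZr//; last 2 first.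
  - by apply: measurableT_comp => //; apply: measurableT_comp.
  - by apply: integral_ge0 => x _; rewrite lee_fin.
  by rewrite lte_mul_pinfty// ?integral_ge0// ge0_fin_numE ?integral_ge0.
have ipXX : (distribution P XXm).-integrable setT h by exact:
  integrable_pushforward.
transitivity (\int[m1]_z h z)%E.
  by rewrite unlock (integral_distribution (X := XYm)).
transitivity (\int[measure_add m2 m3]_z h z)%E.
  by apply: eq_measure_integral => A mA _; exact: joint.
rewrite integral_measure_add//; last 2 first.
- exact: integrable_mscale.
- exact: integrable_mscale.
rewrite !integral_mscale// -gnu; congr (_ * _ + _ * _)%E.
  by rewrite unlock (integral_distribution (X := XXm)).
rewrite -integral12_prod_meas1//=.
under eq_integral => x _.
  rewrite /fubini_F /h /=; under eq_integral => y _ do rewrite EFinM.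
  rewrite integralZl//.
  over.
by rewrite -(fineK fg) integralZr// fineK.
Qed.

(** With variance zero the square of [X - m] vanishes almost surely, so [X] equals its mean with
    probability one and is degenerate. *)
Lemma variance_gt0 (X : T -> R) : inL2 P X -> (0 < 'V_P[X])%E.
Proof.
move=> [X2 ndX]; rewrite lt_neqAle variance_ge0 andbT eq_sym;
  apply/negP => /eqP V0.
apply: ndX; set m := fine 'E_P[X]; exists m.
have mX : measurable_fun setT X.
  by have /andP[+ _] := X2; rewrite inE.
have mh : measurable_fun setT (fun w => ((X w - m) ^+ 2)%:E).
  apply/measurable_EFinP; apply: measurable_funX; exact: measurable_funB.
have : (\int[P]_w `|((X w - m) ^+ 2)%:E| = 0)%E.
  rewrite -V0 /variance unlock unlock; apply: eq_integral => w _.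
  by rewrite gee0_abs ?lee_fin ?sqr_ge0// expr2 /m unlock.
move/(ae_eq_integral_abs P measurableT mh) => [N [mN N0 sN]].
have mXm : measurable [set w | X w = m] by apply: (measurable_preimage (A :=
  [set m]) mX).
have sub : ~` [set w | X w = m] `<=` N.
  move=> w /= Xw; apply: sN => /= /(_ I) /eqP.
  by rewrite eqe sqrf_eq0 subr_eq0 => /eqP.
have := prD P measurableT mXm (@subsetT _ _).
rewrite setTD pr_setT prK// {1}/rprob.
rewrite (subset_measure0 _ mN sub N0)//; last exact: measurableC.
by move=> /= h; congr EFin; lra.
Qed.

(* Under this joint law, the covariance of g(X) and g(Y) is r times the
   variance of g(X), since the product part contributes nothing. *)
Lemma inv_corr_mixture (X Y : T -> R) (r : R) :
  0 <= r <= 1 -> inL2 P X -> inL2 P Y ->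
  (forall A, measurable A -> pr (X @^-1` A) = pr (Y @^-1` A)) ->
  (forall A B, measurable A -> measurable B ->
    pr (X @^-1` A `&` Y @^-1` B) =
    r * pr (X @^-1` (A `&` B)) + (1 - r) * (pr (X @^-1` A) * pr (X @^-1` B))) ->
  inv_corr P X Y r.
Proof.
move=> r01 X2 Y2 sameXY mixXY.
have mX : measurable_fun setT X by have [/andP[+ _] _] := X2; rewrite inE.
have mY : measurable_fun setT Y by have [/andP[+ _] _] := Y2; rewrite inE.
have PXY A : measurable A -> P (X @^-1` A) = P (Y @^-1` A).
  by move=> mA; rewrite !prK ?sameXY//; exact: measurable_preimage.
have main g : measurable_fun setT g -> inL2 P (g \o X) -> inL2 P (g \o Y) ->
    corr P (g \o X) (g \o Y) = r.
  move=> mg gX gY; have [[gX2 _] [gY2 _]] := (gX, gY).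
  have [gX1 gY1] : g \o X \in Lfun P 1 /\ g \o Y \in Lfun P 1.
    by split; apply: Lfun_subset12 => //; exact: fin_num_measure.
  have gXX1 := Lfun2_mul_Lfun1 gX2 gX2.
  have gYY1 := Lfun2_mul_Lfun1 gY2 gY2.
  have gXY1 := Lfun2_mul_Lfun1 gX2 gY2.
  have E1 : ('E_P[g \o Y] = 'E_P[g \o X])%E.
    rewrite unlock; apply/esym/(integral_same_law (h := EFin \o g)) => //.
    - exact/measurable_EFinP.
    - by have /Lfun1_integrable := gX1.
    - by have /Lfun1_integrable := gY1.
  have E2 : ('E_P[(g \o Y) * (g \o Y)] = 'E_P[(g \o X) * (g \o X)])%E.
    rewrite unlock; apply/esym/(integral_same_law (h :=
      fun x => (g x * g x)%:E)) => //.
    - by apply/measurable_EFinP; exact: measurable_funM.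
    - by have /Lfun1_integrable := gXX1.
    - by have /Lfun1_integrable := gYY1.
  have VX : 'V_P[g \o X] = ('E_P[(g \o X) * (g \o X)] - 'E_P[g \o X] * 'E_P[g
    \o X])%E.
    by rewrite /variance covarianceE.
  have VY : 'V_P[g \o Y] = 'V_P[g \o X] by rewrite VX /variance covarianceE//
    E1 E2.
  have := variance_gt0 gX; have := variance_fin_num gX2.
  rewrite /corr VY covarianceE// E1 (expectation_mixture r01 mX mY)// VX.
  rewrite -(fineK (expectation_fin_num gX1)) -(fineK (expectation_fin_num
    gXX1)).
  set e1 := fine 'E_P[g \o X]; set e2 := fine 'E_P[(g \o X) * (g \o X)].
  move=> _; rewrite -!EFinM -EFinD -!EFinB lte_fin /= => v0.
  rewrite -expr2 sqrtr_sqr gtr0_norm//.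
  have v0' : e2 - e1 * e1 != 0 by rewrite gt_eqF.
  by field.
by split => //; exact: (main id (@measurable_id _ _ setT) X2 Y2).
Qed.

End mixture.

(** * Partitions as labellings *)

(** Each index lies in exactly one block, whose label is [phi]; the clique point records which
    labels agree. *)
Lemma partition_block (R : realType) (n k : nat) (A : 'I_k -> {set 'I_n}) :
  is_partition A -> exists phi : 'I_n -> 'I_k,
    forall i j, clique_point R A i j = (phi i == phi j)%:R.
Proof.
move=> [disjA covA].
have block i : exists s, i \in A s.
  have : i \in (\bigcup_(s < k) A s)%SET by rewrite covA finset.inE.
  by move=> /bigcupP[s _ iAs]; exists s.
have [phi phiA] := choice block; exists phi => i j.
have memA l s : (l \in A s) = (phi l == s).
  apply/idP/eqP => [lAs|<-//]; apply/eqP; apply: contraT => /disjA /eqP dis.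
  by have : l \in finset.set0 by [rewrite -dis finset.inE phiA];
    rewrite finset.inE.
rewrite /clique_point mxE (bigD1 (phi i)) //= !memA eqxx /= big1 ?addr0
  1?eq_sym//.
by move=> s /negPf si; rewrite memA eq_sym si.
Qed.

Lemma block_partition (R : realType) (n k : nat) (phi : 'I_n -> 'I_k) :
  exists A : 'I_k -> {set 'I_n}, is_partition A /\
    forall i j, clique_point R A i j = (phi i == phi j)%:R.
Proof.
pose A s := [set i | phi i == s]%SET.
have pA : is_partition A.
  split=> [s t st|].
    apply/eqP/setP => i; rewrite !finset.inE.
    by apply/negP => /andP[/eqP-> ts]; rewrite (negbTE st) in ts.
  by apply/setP => i; rewrite finset.inE; apply/bigcupP; exists (phi i);
    rewrite // finset.inE.
exists A; split => // i j; rewrite /clique_point mxE (bigD1 (phi i)) //=.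
rewrite !finset.inE eqxx /= big1 ?addr0 1?eq_sym// => s /negPf si.
by rewrite finset.inE eq_sym si.
Qed.

(** * Realising convex combinations of clique points *)

Section realisation.
Context {d0 : measure_display} {T : measurableType d0} {R : realType}
  (P : probability T R).
Local Notation pr := (rprob P).

Lemma bounded_Lfun2 (X : T -> R) : measurable_fun setT X ->
  (forall w, `|X w| <= 1) -> X \in Lfun P 2%:E.
Proof.
move=> mX X1; rewrite inE; apply/andP; split; first by rewrite inE.
rewrite inE /= /finite_norm unlock /Lnorm; apply: poweR_lty.
rewrite (@le_lt_trans _ _ (\int[P]_w 1%:E)%E)//.
  apply: ge0_le_integral => //.
  - by move=> w _; rewrite lee_fin powR_ge0.
  - apply/measurable_EFinP.
    apply: (measurableT_comp (measurable_powR _)) => //;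
      exact: measurableT_comp.
  - move=> w _; rewrite lee_fin powR_mulrn//; apply: exprn_ile1 => //.
by rewrite integral_cst//= probability_setT mule1 ltry.
Qed.

Lemma conv_subset_Theta (n : nat) : atomless P ->
  conv_hull (Sset R n n) `<=` Theta P n.
Proof.
move=> atP _ [[|m] [w [Q [w0 w1 SQ ->]]]].
  (* An empty family of weights cannot sum to one. *)
  by move: w1; rewrite big_ord0 => /eqP; rewrite eq_sym oner_eq0.
have [phi phiP] : exists phi : 'I_m.+1 -> 'I_n -> 'I_n,
    forall q i j, Q q i j = (phi q i == phi q j)%:R.
  suff /choice[phi phiP] : forall q, exists phi : 'I_n -> 'I_n,
      forall i j, Q q i j = (phi i == phi j)%:R by exists phi.
  by move=> q; have [A [pA ->]] := SQ q; exact: partition_block.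
have [f0 f0P] := weighted_partition atP w0 w1.
have mf0 q : measurable (f0 @^-1` [set q]) by have [] := f0P q.
have pf0 q : pr (f0 @^-1` [set q]) = w q by have [] := f0P q.
pose f x : nat := f0 x.
have mf i : measurable (f @^-1` [set i]).
  have [im|mi] := ltnP i m.+1.
    rewrite (_ : _ @^-1` _ = f0 @^-1` [set Ordinal im])//.
    by apply/seteqP; split=> x /= fx; [exact: val_inj|rewrite /f fx].
  rewrite (_ : _ @^-1` _ = set0)//; apply/seteqP; split=> // x /= fx.
  by move: mi; rewrite -fx leqNgt ltn_ord.
have [b coins] := fair_coins atP mf.
pose U (s : nat) : T -> R := digits b n s.
pose X i x := U (phi (f0 x) i) x.
pose nu A := pr (U 0%N @^-1` A).
(* Which partition is drawn depends on [f] alone, before any coin is tossed, so the variables [U s]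
   keep their law given this event. *)
have dE q : determined f b 0 (f0 @^-1` [set q]).
  by move=> x x' fxx' _ /= <-; apply: val_inj.
have mU (s : 'I_n) : measurable_fun setT (U s).
  by apply: (measurable_digits coins); exact: ltn_ord.
have mX i : measurable_fun setT (X i).
  rewrite (_ : X i = fun x => \sum_q \1_(f0 @^-1` [set q]) x * U (phi q i) x).
    apply: measurable_sum => q; apply: measurable_funM => //.
  apply/funext => x; rewrite (bigD1 (f0 x))//= indicE mem_set// mul1r big1
    ?addr0//.
  move=> q qf; rewrite indicE memNset ?mul0r//= => /eqP.
  by rewrite eq_sym (negbTE qf).
pose r i j := \sum_q w q * (phi q i == phi q j)%:R.
have rii i : r i i = 1 by rewrite -w1; apply: eq_bigr => q _;
  rewrite eqxx mulr1.
(* Given the partition [q], two indices of one block share a single variable, which gives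
   [nu (A & B)] for the intersection; otherwise their variables are independent, which gives the
   product. Averaging over [q] yields the mixture. *)
have joint i j A B : measurable A -> measurable B ->
    pr (X i @^-1` A `&` X j @^-1` B) =
    r i j * nu (A `&` B) + (1 - r i j) * (nu A * nu B).
  move=> mA mB.
  have mAB : measurable (X i @^-1` A `&` X j @^-1` B).
    by apply: measurableI; exact: measurable_preimage.
  rewrite (pr_fibers P mAB mf0).
  rewrite /r -[X in X - _]w1 -sumrB !big_distrl /= -big_split /=;
    apply: eq_bigr => q _.
  have -> : X i @^-1` A `&` X j @^-1` B `&` f0 @^-1` [set q] =
      f0 @^-1` [set q] `&` U (phi q i) @^-1` A `&` U (phi q j) @^-1` B.
    by apply/seteqP; split=> x /=; rewrite /X => -[[]];
      [move=> + + fq|move=> fq]; rewrite fq.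
  have [<-|neq] := eqVneq (phi q i) (phi q j).
    rewrite -setIA -preimage_setI (digits_law coins) ?pf0//.
    - by rewrite mulr1 subrr mul0r addr0.
    - exact: measurableI.
  rewrite (digits_law2 coins) ?pf0//.
  by rewrite mulr0 mul0r add0r subr0 mulrA.
have lawX i A : measurable A -> pr (X i @^-1` A) = nu A.
  move=> mA; have := joint i i A setT mA measurableT.
  by rewrite preimage_setT !setIT rii mul1r subrr mul0r addr0.
have contX : continuous_rvec P X.
  move=> i x; rewrite prK; last by exact: (measurable_preimage (A := [set x])).
  have n0 : (0 < n)%N by exact: leq_ltn_trans (ltn_ord i).
  by rewrite (lawX i [set x])// /nu (digits_continuous coins x n0).
have L2X i : inL2 P (X i).
  split.
    (* The bounds at stage 0 place every variable in the interval from 0 to 1/2. *)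
    apply: bounded_Lfun2 => // x; rewrite /X /U.
    have := @digits_bounds _ _ R b n 0%N (phi (f0 x) i) x.
    rewrite /partial_digits big_ord0 expr0 invr1 => /andP[? ?].
    by rewrite ger0_norm; lra.
  by move=> [c]; rewrite contX => /esym/eqP; rewrite onee_eq0.
exists X; split => //.
  move=> i j B mB; rewrite !prK; [|exact: measurable_preimage..].
  by rewrite !lawX.
move=> i j; apply: inv_corr_mixture => //.
- rewrite summxE (eq_bigr (fun q => w q * (phi q i == phi q j)%:R)); last first.
    by move=> q _; rewrite mxE phiP.
  apply/andP; split; first by apply: sumr_ge0 => q _; rewrite mulr_ge0.
  by rewrite -[leRHS]w1; apply: ler_sum => q _; rewrite ler_piMr// lern1 leq_b1.
- by move=> A mA; rewrite !lawX.
- move=> A B mA mB; rewrite joint// !lawX//; last exact: measurableI.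
  suff -> : (\sum_q w q *: Q q) i j = r i j by [].
  by rewrite summxE; apply: eq_bigr => q _; rewrite mxE phiP.
Qed.
End realisation.

(** * Invariant correlation tested on indicators *)

Section diagonal.
Context {d0 : measure_display} {T : measurableType d0} {R : realType}
  (P : probability T R).
Local Notation pr := (rprob P).

Lemma indic_Lfun2 (A : set T) : measurable A -> (\1_A : T -> R) \in Lfun P 2%:E.
Proof.
move=> mA; apply: bounded_Lfun2; first exact: measurable_indic.
by move=> w; rewrite indicE; case: (_ \in _); rewrite ?normr1 ?normr0 ?ler01.
Qed.

Lemma covariance_indic (A B : set T) : measurable A -> measurable B ->
  covariance P \1_A \1_B = (pr (A `&` B) - pr A * pr B)%:E.
Proof.
move=> mA mB; have A2 := indic_Lfun2 mA; have B2 := indic_Lfun2 mB.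
rewrite covarianceE.
- rewrite (_ : (\1_A * \1_B : T -> R) = \1_(A `&` B)).
    rewrite !expectation_indic//; last exact: measurableI.
    by rewrite !prK//; exact: measurableI.
  by rewrite indicI.
- by apply: Lfun_subset12 => //; exact: fin_num_measure.
- by apply: Lfun_subset12 => //; exact: fin_num_measure.
- exact: Lfun2_mul_Lfun1.
Qed.

Lemma inv_corr_diagonal (X Y : T -> R) (r : R) (A : set R) :
  inv_corr P X Y r -> measurable A -> pr (X @^-1` A) = pr (Y @^-1` A) ->
  pr (X @^-1` A `&` Y @^-1` A) =
    r * pr (X @^-1` A) + (1 - r) * pr (X @^-1` A) ^+ 2.
Proof.
move=> [X2 Y2 _ gcorr] mA XY.
have mX : measurable_fun setT X by have [/andP[+ _] _] := X2; rewrite inE.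
have mY : measurable_fun setT Y by have [/andP[+ _] _] := Y2; rewrite inE.
have mXA := measurable_preimage mX mA.
have mYA := measurable_preimage mY mA.
have mXYA := measurableI _ _ mXA mYA.
(* When the probability is 0 or 1 the indicator is degenerate and invariance says nothing about it;
   the formula is then checked directly. *)
have [p0|p0] := eqVneq (pr (X @^-1` A)) 0.
  rewrite p0 expr0n /= !mulr0 addr0; apply/eqP; rewrite eq_le pr_ge0 andbT -p0.
  by apply: le_pr.
have [p1|p1] := eqVneq (pr (X @^-1` A)) 1.
  rewrite p1 expr1n !mulr1 addrC subrK.
  have := pr_split P mXA mYA; rewrite p1.
  have : pr (X @^-1` A `\` Y @^-1` A) <= pr (setT `\` Y @^-1` A).
    by apply: le_pr; [exact: measurableD|exact: measurableD|move=> w []].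
  rewrite (prD P measurableT mYA (@subsetT _ _)) pr_setT -XY p1 subrr => le0.
  have := pr_ge0 P (X @^-1` A `\` Y @^-1` A); lra.
(* If the indicator were almost surely a constant [c], then [c = 1] would force probability 1 and
   [c = 0] probability 0, while no other value is attained. *)
have indL2 (Z : T -> R) : measurable_fun setT Z ->
    pr (Z @^-1` A) = pr (X @^-1` A) -> inL2 P (\1_A \o Z).
  move=> mZ ZX; have mZA := measurable_preimage mZ mA; split.
    exact: (indic_Lfun2 mZA).
  move=> [c Pc].
  have indZ w : (\1_A \o Z) w = \1_(Z @^-1` A) w by [].
  have [c1|c1] := eqVneq c 1.
    move: p1; rewrite -ZX => /eqP; apply;
      rewrite -[RHS](_ : fine (1%E : \bar R) = 1)//.
    rewrite -Pc /rprob; congr (fine (P _)); apply/seteqP; split=> w /=.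
      by move=> ZA; rewrite c1 indicE mem_set.
    rewrite c1 indicE; case: (boolP (Z w \in A)) => [/set_mem//|_ /eqP].
    by rewrite eq_sym oner_eq0.
  have [c0|c0] := eqVneq c 0.
    have mc : measurable (~` (Z @^-1` A)) by exact: measurableC.
    have : pr (~` (Z @^-1` A)) = 1.
      rewrite -[RHS](_ : fine (1%E : \bar R) = 1)// -Pc /rprob.
      congr (fine (P _)); apply/seteqP; split=> w /=.
        by move=> ZA; rewrite c0 indicE memNset.
      rewrite c0 indicE; case: (boolP (Z w \in A)) => [_ /eqP|/negP ZA _ Zw].
        by rewrite oner_eq0.
      by apply: ZA; exact: mem_set.
    rewrite -setTD prD// pr_setT ZX => h; move: p0 => /eqP; apply; lra.
  have : P [set w | (\1_A \o Z) w = c] = 0%E.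
    rewrite [X in P X](_ : _ = set0) ?measure0//; apply/seteqP; split=> w //=.
    rewrite indicE; case: (_ \in _) => /eqP; rewrite eq_sym.
      by rewrite (negbTE c1).
    by rewrite (negbTE c0).
  by rewrite Pc => /eqP; rewrite onee_eq0.
have mg : measurable_fun setT (\1_A : R -> R) by exact: measurable_indic.
have := gcorr \1_A mg (indL2 X mX erefl) (indL2 Y mY (esym XY)).
rewrite /corr /variance.
rewrite (covariance_indic mXA mYA) (covariance_indic mXA mXA) (covariance_indic
  mYA mYA).
rewrite /= !setIid -XY.
set p := pr (X @^-1` A) in p0 p1 *; set j := pr _.
have pp : 0 < p - p * p.
  have p0' : 0 < p by rewrite lt_neqAle eq_sym p0 pr_ge0.
  have p1' : p < 1.
    by rewrite lt_neqAle p1 -(pr_setT P) le_pr.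
  by rewrite -{1}[p]mulr1 -mulrBr mulr_gt0// subr_gt0.
rewrite -expr2 sqrtr_sqr gtr0_norm// => <-.
by field; rewrite gt_eqF.
Qed.

End diagonal.

(** * Cells of the line cut out by rationals *)

Section cells.
Context {R : realType}.

(** An enumeration of the rationals; a number that codes none is sent to 0, which merely repeats a
    cut point. *)
Definition rational (j : nat) : R := ratr (odflt 0%Q (unpickle j)).

(** A cell is named by the side of each cut point on which it lies, so the label is finite-valued
    and some labels may have an empty fibre. *)
Definition cell (m : nat) (x : R) : {ffun 'I_m -> bool} :=
  [ffun j : 'I_m => x < rational j].

Lemma cell_eqP m x y :
  cell m x = cell m y <-> forall j, (j < m)%N -> (x < rational j) = (y <
    rational j).
Proof.
split=> [/ffunP xy j jm|xy]; first by have := xy (Ordinal jm); rewrite !ffunE.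
by apply/ffunP => j; rewrite !ffunE xy.
Qed.

Lemma cells_separate x y : (forall m, cell m x = cell m y) -> x = y.
Proof.
wlog xy : x y / x <= y => [hwlog|] cxy.
  by case: (leP x y) => [/hwlog|/ltW/hwlog h]; [exact|exact/esym/h].
apply/eqP; rewrite eq_le xy /= leNgt; apply/negP => xlty.
have [q xqy] := rat_in_itvoo xlty.
(* A rational [q] between the two points is among the first [(pickle q).+1] cut points, and it
   separates them. *)
have /cell_eqP/(_ (pickle q) (ltnSn _)) := cxy (pickle q).+1.
rewrite /rational pickleK /=; move: xqy; rewrite in_itv /= => /andP[-> qy].
by rewrite ltNge (ltW qy).
Qed.

Lemma measurable_cell m c : measurable (cell m @^-1` [set c]).
Proof.
rewrite (_ : _ @^-1` _ = \bigcap_(j in [set: 'I_m])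
    (if c j then `]-oo, rational j[%classic else `[rational j, +oo[%classic)).
  apply: fin_bigcap_measurable; first exact: finite_finset.
  by move=> j _; case: (c j).
apply/seteqP; split=> x /=.
  by move=> <- j _; rewrite ffunE; case: ltP => /= xj; rewrite in_itv /= ?andbT.
move=> xc; apply/ffunP => j; rewrite ffunE; have := xc j Logic.I.
by case: (c j) => /=; rewrite in_itv /= ?andbT // => xj; apply/negbTE;
  rewrite -leNgt.
Qed.

End cells.

Section same_cell.
Context {d0 : measure_display} {T : measurableType d0} {R : realType}
  (P : probability T R).

Definition same_cell (X Y : T -> R) (m : nat) : set T :=
  [set w | cell m (X w) = cell m (Y w)].

Lemma same_cellE (X Y : T -> R) m : same_cell X Y m =
  \bigcup_(c in [set: {ffun 'I_m -> bool}])
    (X @^-1` (cell m @^-1` [set c]) `&` Y @^-1` (cell m @^-1` [set c])).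
Proof.
apply/seteqP; split=> w /=; first by move=> h; exists (cell m (X w)) => //=;
  split.
by move=> [c _ [/= Xc Yc]]; rewrite /same_cell /= Xc Yc.
Qed.

Lemma measurable_same_cell (X Y : T -> R) m :
  measurable_fun setT X -> measurable_fun setT Y -> measurable (same_cell X Y
    m).
Proof.
move=> mX mY; rewrite same_cellE; apply: fin_bigcup_measurable;
  first exact: finite_finset.
by move=> c _; apply: measurableI; apply: measurable_preimage => //;
  exact: measurable_cell.
Qed.

Lemma pr_same_cell (X Y : T -> R) m :
  measurable_fun setT X -> measurable_fun setT Y ->
  rprob P (same_cell X Y m) = \sum_c rprob P (X @^-1` (cell m @^-1` [set c]) `&`
                                        Y @^-1` (cell m @^-1` [set c])).
Proof.
move=> mX mY.
have mL c : measurable ((cell m \o X) @^-1` [set c]).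
  by apply: (measurable_preimage mX (measurable_cell c)).
rewrite (pr_fibers P (measurable_same_cell m mX mY) mL); apply: eq_bigr => c _.
congr (rprob P _); apply/seteqP; split=> w /=; rewrite /same_cell /=.
  by move=> [XY Xc]; rewrite -XY.
by move=> [Xc Yc]; rewrite Xc Yc.
Qed.

(** More cut points make the event smaller, and by [cells_separate] only equality of the two values
    survives all of them. *)
Lemma same_cell_cvg (X Y : T -> R) :
  measurable_fun setT X -> measurable_fun setT Y ->
  rprob P (same_cell X Y m) @[m --> \oo] --> rprob P [set w | X w = Y w].
Proof.
move=> mX mY; rewrite (_ : [set w | X w = Y w] = \bigcap_m same_cell X Y m).
  apply: pr_nonincreasing_cvg => [m|m k mk]; first exact: measurable_same_cell.
  apply/subsetPset => w; rewrite /same_cell /= => /cell_eqP h;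
    apply/cell_eqP => j jm.
  by apply: h; exact: leq_trans mk.
apply/seteqP; split=> w /=; first by move=> XY m _; rewrite /same_cell /= XY.
by move=> XY; apply: cells_separate => m; exact: XY.
Qed.

End same_cell.

(** * The correlation as a probability of equality *)

Section equality.
Context {d0 : measure_display} {T : measurableType d0} {R : realType}
  (P : probability T R).
Local Notation pr := (rprob P).

(* Two independent copies of a continuous variable almost surely differ. *)
Lemma square_cells_cvg (X : T -> R) : measurable_fun setT X ->
  (forall x, P [set w | X w = x] = 0%E) ->
  (fun m => \sum_c pr (X @^-1` (cell m @^-1` [set c])) ^+ 2) @ \oo --> (0 : R).
Proof.
move=> mX X0.
pose Xm : {mfun T >-> R} := HB.pack X (isMeasurableFun.Build _ _ _ _ _ mX).
pose nu : probability R R := distribution P Xm.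
pose P2 : probability (R * R)%type R := (nu \x nu)%E.
(* Under the product law [P2] the sum of squares is the probability that the two coordinates share a
   cell. Its limit is the mass of the diagonal, which is zero because each section is a single
   point, null for [nu]. *)
have := same_cell_cvg (P := P2) measurable_fst measurable_snd.
rewrite (_ : rprob P2 [set w | w.1 = w.2] = 0); last first.
  rewrite /rprob /P2 /= /product_measure1 integral0_eq// => x _ /=.
  rewrite (_ : xsection _ x = [set x]); first exact: X0.
  by apply/seteqP; split=> y; rewrite /xsection /= inE.
apply: cvg_trans; apply: near_eq_cvg; apply: nearW => m.
rewrite pr_same_cell//; apply: eq_bigr => c _.
rewrite (_ : _ `&` _ = (cell m @^-1` [set c]) `*` (cell m @^-1` [set c]))//.
rewrite /rprob /P2 /= product_measure1E; [|exact: measurable_cell..].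
have mc := measurable_preimage mX (measurable_cell c).
by rewrite fineM ?expr2 ?fin_num_measure//; exact: measurable_cell.
Qed.

Lemma inv_corr_pr_eq (X Y : T -> R) (r : R) :
  inv_corr P X Y r -> (forall x, P [set w | X w = x] = 0%E) ->
  (forall A, measurable A -> pr (X @^-1` A) = pr (Y @^-1` A)) ->
  pr [set w | X w = Y w] = r.
Proof.
move=> icXY X0 XY.
have mX : measurable_fun setT X by have [[/andP[+ _] _] _ _ _] := icXY;
  rewrite inE.
have mY : measurable_fun setT Y by have [_ [/andP[+ _] _] _ _] := icXY;
  rewrite inE.
have := same_cell_cvg (P := P) mX mY.
have -> : (fun m => pr (same_cell X Y m)) =
    (fun m => r + (1 - r) * \sum_c pr (X @^-1` (cell m @^-1` [set c])) ^+ 2).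
  apply/funext => m; rewrite pr_same_cell//.
  rewrite (eq_bigr (fun c => r * pr (X @^-1` (cell m @^-1` [set c])) +
      (1 - r) * pr (X @^-1` (cell m @^-1` [set c])) ^+ 2)); last first.
    move=> c _; have mc := @measurable_cell R m c.
    exact: inv_corr_diagonal icXY mc (XY _ mc).
  rewrite big_split /= -!mulr_sumr; congr (_ + _).
  rewrite -[RHS]mulr1 -(pr_setT P); congr (_ * _).
  rewrite (pr_fibers P measurableT (L := cell m \o X)).
    by apply: eq_bigr => c _; rewrite setTI.
  by move=> c; exact: measurable_preimage mX (measurable_cell c).
move=> cvg1; apply: (cvg_unique _ cvg1) => //=.
have : (fun m => r + (1 - r) * \sum_c pr (X @^-1` (cell m @^-1` [set c])) ^+ 2)
    @ \oo --> r + (1 - r) * 0.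
  by apply: cvgD; [exact: cvg_cst|apply: cvgMr; exact: square_cells_cvg].
by rewrite mulr0 addr0.
Qed.
End equality.

(** * Random equivalence relations and categorical matrices *)

Section categories.
Context {d0 : measure_display} {T : measurableType d0} {R : realType}
  (P : probability T R).
Local Notation pr := (rprob P).

(** Each class is labelled by its smallest member. This choice is canonical, so an event fixing the
    label is a finite combination of the events [e w i j]. *)
Lemma equivalence_classes (n : nat) (e : T -> rel 'I_n) :
  (forall w, equivalence_rel (e w)) ->
  (forall i j, measurable [set w | e w i j]) ->
  exists kappa : T -> 'I_n -> 'I_n,
    (forall w i j, (kappa w i == kappa w j) = e w i j) /\
    (forall i l, measurable [set w | kappa w i = l]).
Proof.
move=> eqe me; have exx w i : e w i i by case: (eqe w i i i).
have eC w i j : e w i j = e w j i.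
  apply/idP/idP => eij; have := (eqe w _ _ _).2 eij; first by move/(_ i) <-.
  by move/(_ j) <-.
pose kappa w i := [arg min_(l < i | e w i l) l]%N.
have kP w i l : kappa w i = l <-> e w i l /\ forall j, e w i j -> (l <= j)%N.
  rewrite /kappa; case: arg_minnP => // l' el' minl'; split=> [<- //|[el minl]].
  by apply/val_inj/eqP; rewrite eqn_leq minl'// minl.
exists kappa; split=> [w i j|i l].
  apply/eqP/idP => [kij|eij].
    have [+ _] := (kP w j _).1 erefl; have [+ _] := (kP w i _).1 erefl.
    rewrite kij eC => /(eqe w _ _ _).2 h; rewrite (eC _ j); by rewrite h.
  have [ek mink] := (kP w j _).1 erefl.
  by apply/kP; split=> [|l]; rewrite ((eqe w _ _ _).2 eij)//; exact: mink.
rewrite (_ : [set w | _ = _] = [set w | e w i l] `&`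
    \bigcap_(j in [set j : 'I_n | (j < l)%N]) ~` [set w | e w i j]).
  apply: measurableI => //; apply: fin_bigcap_measurable => [|j _].
    exact: finite_finset.
  exact: measurableC.
apply/seteqP; split=> w /=.
  move=> /kP[el minl]; split=> // j /= jl /minl.
  by rewrite leqNgt jl.
move=> [el minl]; apply/kP; split=> // j ej; rewrite leqNgt; apply/negP => jl.
exact: minl ej.
Qed.

(** The labelling takes finitely many values [c]. Conditioning on it, the weight of [c] is its
    probability, and the corresponding vertex is the clique point of the partition that [c]
    defines. *)
Lemma equivalence_conv_hull (n : nat) (e : T -> rel 'I_n) :
  (forall w, equivalence_rel (e w)) ->
  (forall i j, measurable [set w | e w i j]) ->
  conv_hull (Sset R n n) (\matrix_(i, j) pr [set w | e w i j]).
Proof.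
move=> eqe me; have [kappa [kE mk]] := equivalence_classes eqe me.
pose L w : {ffun 'I_n -> 'I_n} := [ffun i => kappa w i].
have mL c : measurable (L @^-1` [set c]).
  rewrite (_ : _ @^-1` _ = \bigcap_(i in [set: 'I_n]) [set w | kappa w i = c
    i]).
    by apply: fin_bigcap_measurable => //; exact: finite_finset.
  apply/seteqP; split=> w /= => [<- i _|h]; first by rewrite /= ffunE.
  by apply/ffunP => i; rewrite ffunE; exact: h.
have [A AP] := choice (fun c : {ffun 'I_n -> 'I_n} => block_partition R c).
(* Convex combinations are indexed by ordinals, so the labellings are enumerated. *)
have sum_enum (V : nmodType) (F : {ffun 'I_n -> 'I_n} -> V) :
    \sum_(q < #|{: {ffun 'I_n -> 'I_n}}|) F (enum_val q) = \sum_c F c.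
  exact/esym/(reindex _ (onW_bij _ (enum_val_bij _))).
exists #|{: {ffun 'I_n -> 'I_n}}|, (fun q => pr (L @^-1` [set enum_val q])),
  (fun q => clique_point R (A (enum_val q))); split.
- by move=> q; exact: pr_ge0.
- rewrite (sum_enum _ (fun c => pr (L @^-1` [set c]))) -(pr_setT P).
  by rewrite (pr_fibers P measurableT mL); apply: eq_bigr => c _; rewrite setTI.
- by move=> q; exists (A (enum_val q)); split => //; have [] := AP (enum_val q).
- rewrite (sum_enum _ (fun c => pr (L @^-1` [set c]) *: clique_point R (A c))).
  apply/matrixP => i j; rewrite summxE mxE (pr_fibers P (me i j) mL).
  apply: eq_bigr => c _; have [_ Ac] := AP c; rewrite mxE Ac.
  case: eqVneq => cij; rewrite ?mulr1 ?mulr0.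
    congr pr; apply/seteqP; split=> w /=; first by case.
    by move=> Lc; split => //; rewrite -kE; move: cij; rewrite -Lc !ffunE => ->.
  rewrite (_ : _ `&` _ = set0) ?pr_set0//; apply/seteqP; split=> w //= [].
  by rewrite -kE => /eqP kij Lc; move: cij; rewrite -Lc !ffunE kij eqxx.
Qed.

(** A row of zeros and ones with sum 1 has some entry 1, and the other entries, being nonnegative
    with sum 0, all vanish. *)
Lemma categorical_row (n k : nat) (G : T -> 'M[R]_(n, k)) : categorical G ->
  exists cat : T -> 'I_n -> 'I_k, forall w i l, G w i l = (cat w i == l)%:R.
Proof.
move=> [_ G01 G1].
have row w i : exists l0, forall l, G w i l = (l0 == l)%:R.
  have [l0 Gl0] : exists l0, G w i l0 = 1.
    apply: contrapT => no; have := G1 w i; rewrite big1 => [/eqP|l _].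
      by rewrite eq_sym oner_eq0.
    by have [//|Gl] := G01 w i l; exfalso; apply: no; exists l.
  exists l0 => l; have [<-//|ne] := eqVneq l0 l.
  have := G1 w i; rewrite (bigD1 l0)//= Gl0 => /eqP.
  rewrite -subr_eq0 addrAC subrr add0r psumr_eq0; last first.
    by move=> j _; have [->|->] := G01 w i j.
  by move=> /allP/(_ l (mem_index_enum l)); rewrite eq_sym ne => /eqP.
have [cat catP] := choice (fun wi : T * 'I_n => row wi.1 wi.2).
by exists (fun w i => cat (w, i)) => w i l; exact: (catP (w, i)).
Qed.

Lemma gram_indicator (n k : nat) (G : 'M[R]_(n, k)) (c : 'I_n -> 'I_k) :
  (forall i l, G i l = (c i == l)%:R) ->
  forall i j, (G *m G^T) i j = (c i == c j)%:R.
Proof.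
move=> Gc i j; rewrite mxE (bigD1 (c i))//= mxE !Gc eqxx mul1r big1 ?addr0
  1?eq_sym//.
by move=> l /negPf lc; rewrite Gc eq_sym lc mul0r.
Qed.

Lemma expectation_event (b : T -> bool) : measurable [set w | b w] ->
  fine ('E_P[fun w => (b w)%:R]) = pr [set w | b w].
Proof.
move=> mb; rewrite (_ : (fun w => _) = \1_[set w | b w]) ?expectation_indic//.
by apply/funext => w; rewrite indicE mem_setE.
Qed.

(** The matrix depends only on the relation of being in the same category. Its classes can be
    relabelled by the [n] indices, which is how [k] drops out. *)
Lemma Zset_subset_conv_hull (n k : nat) : Zset P n k `<=` conv_hull (Sset R n
  n).
Proof.
move=> _ [G [Gcat ->]]; have [cat catP] := categorical_row Gcat.
have [mG _ _] := Gcat.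
pose e w : rel 'I_n := fun i j => cat w i == cat w j.
have me i j : measurable [set w | e w i j].
  rewrite (_ : [set w | _] = \bigcup_(l in [set: 'I_k])
      ([set w | G w i l = 1] `&` [set w | G w j l = 1])).
    apply: fin_bigcup_measurable => [|l _]; first exact: finite_finset.
    by apply: measurableI; exact: (measurable_preimage (A := [set 1]) (mG _ _)).
  apply/seteqP; split=> w /=; rewrite /e.
    by move=> /eqP cij; exists (cat w i) => //=; rewrite !catP cij eqxx.
  move=> [l _ []] /=; rewrite !catP; case: eqP => [->|_ /eqP];
    last by rewrite eq_sym oner_eq0.
  by move=> _; case: eqP => [->//|_ /eqP]; rewrite eq_sym oner_eq0.
have eqe w : equivalence_rel (e w).
  by move=> i j l; split; rewrite /e // => /eqP->.
have := equivalence_conv_hull eqe me; congr (conv_hull _ _).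
apply/matrixP => i j; rewrite !mxE -expectation_event//; congr (fine 'E_P[_]).
by apply/funext => w; rewrite (gram_indicator (catP w)).
Qed.

(** The category of [i] is the smallest index whose variable takes the same value as [X i], so [n]
    categories suffice. *)
Lemma Theta_subset_Zset (n : nat) : Theta P n `<=` Zset P n n.
Proof.
move=> M [X [contX sameX icX]].
have mX i : measurable_fun setT (X i).
  by have [[/andP[+ _] _] _ _ _] := icX i i; rewrite inE.
have prX i j A : measurable A -> pr (X i @^-1` A) = pr (X j @^-1` A).
  by move=> mA; rewrite /rprob (sameX i j A mA).
pose e w : rel 'I_n := fun i j => X i w == X j w.
have me i j : measurable [set w | e w i j].
  rewrite -[X in measurable X]setTI.
  exact: (measurable_fun_eqr (mX i) (mX j) measurableT (Y := [set true])).
have eqe w : equivalence_rel (e w).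
  by move=> i j l; split; rewrite /e // => /eqP->.
have [kappa [kE mk]] := equivalence_classes eqe me.
exists (fun w => \matrix_(i, l) (kappa w i == l)%:R); split.
  split=> [i l|w i l|w i].
  - rewrite (_ : (fun w => _) = \1_[set w | kappa w i = l]).
      exact: measurable_indic.
    apply/funext => w; rewrite mxE indicE; congr (nat_of_bool _)%:R.
    by apply/eqP/idP => [h|/set_mem//]; rewrite inE.
  - by rewrite mxE; case: eqP; [right|left].
  - rewrite (bigD1 (kappa w i))//= mxE eqxx big1 ?addr0// => l /negPf lk.
    by rewrite mxE eq_sym lk.
apply/matrixP => i j; rewrite mxE.
rewrite -(inv_corr_pr_eq (icX i j) (contX i) (prX i j)).
rewrite (_ : [set w | X i w = X j w] = [set w | e w i j]); last first.
  by apply/seteqP; split=> w /= /eqP.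
rewrite -expectation_event//; congr (fine 'E_P[_]); apply/funext => w.
by rewrite (gram_indicator (c := kappa w)) ?kE// => a b; rewrite mxE.
Qed.

End categories.

Theorem theorem4 (R : realType) (d0 : measure_display) (T : measurableType d0)
  (P : probability T R) (n : nat) :
  atomless P -> (2 <= n)%N ->
  [/\ Theta P n = Zset P n n,
      Zset P n n = [set M | exists k : nat, Zset P n k M] &
      [set M | exists k : nat, Zset P n k M] = conv_hull (Sset R n n)].
Proof.
move=> atP _.
have ThZ := @Theta_subset_Zset _ _ _ P n.
have ZU : Zset P n n `<=` [set M | exists k : nat, Zset P n k M] by move=> M;
  exists n.
have UC : [set M | exists k : nat, Zset P n k M] `<=` conv_hull (Sset R n n).
  by move=> M [k]; exact: Zset_subset_conv_hull.
have CTh := conv_subset_Theta (n := n) atP.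
split; apply/seteqP; split=> // M.
- by move/ZU/UC/CTh.
- by move/UC/CTh/ThZ.
- by move/CTh/ThZ/ZU.
Qed.
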